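(* Let $\mu_0\in\mathcal{N}_n$, let $(\cdot,\cdot)$ be an inner product on $\mathbb{R}^n$, and let $g(t)$ be the Ricci flow starting at $g=g_{\mu_0,(\cdot,\cdot)}$. Let $\{h(t)\}\subset\mathrm{GL}_n(\mathbb{R})$ be the solution to $\frac{d}{dt}h(t)=-h(t)\operatorname{Ric}(g(t))(0)$, $h(0)=I$, where $\operatorname{Ric}(g(t))(0)$ is the Ricci operator of $g(t)$ at $0$. Then $(h(t)^{-1})^*g(t)$ is the negative gradient flow of the square norm of the Ricci tensor, in the following sense: for all $t$, $$(h(t)^{-1})^*g(t)=g_{\mu(t),(\cdot,\cdot)},$$ where $\mu(t)\in\mathcal{N}_n$ is the solution to $$\frac{d}{dt}\mu(t)=-\operatorname{grad}(F)_{\mu(t)},\qquad\mu(0)=\mu_0,\qquad F(\mu)=\operatorname{tr}(\operatorname{Ric}_\mu^2).$$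
   Context: $V_n$ is the vector space of skew-symmetric bilinear maps $\mathbb{R}^n\times\mathbb{R}^n\to\mathbb{R}^n$, and $\mathcal{N}_n\subset V_n$ is the set of those that satisfy the Jacobi identity and are nilpotent. For $\mu\in\mathcal{N}_n$, $(\mathbb{R}^n,\cdot_\mu)$ is the simply connected nilpotent Lie group with Lie algebra $(\mathbb{R}^n,\mu)$, identified with $\mathbb{R}^n$ via its exponential map (so $\cdot_\mu$ is given by the Baker-Campbell-Hausdorff formula), and $g_{\mu,(\cdot,\cdot)}$ is the left-invariant Riemannian metric on $(\mathbb{R}^n,\cdot_\mu)$ whose value at $0$ is $(\cdot,\cdot)$; these are the metrics on $\mathbb{R}^n$ regarded as invariant under a transitive nilpotent Lie group. The Ricci flow is $\frac{\partial}{\partial t}g(t)=-2\operatorname{Rc}(g(t))$, with $g(t)$ being $(\mathbb{R}^n,\cdot_{\mu_0})$-invariant for all $t$. Fix a $(\cdot,\cdot)$-orthonormal basis $\{e_i\}$ of $\mathbb{R}^n$, with transposes taken with respect to $(\cdot,\cdot)$. $\operatorname{Ric}_\mu=-\frac12\sum_i(\operatorname{ad}_\mu e_i)^t\operatorname{ad}_\mu e_i+\frac14\sum_i\operatorname{ad}_\mu e_i(\operatorname{ad}_\mu e_i)^t$ for $\mu\in V_n$; for $\mu\in\mathcal{N}_n$ this is the Ricci operator of $g_{\mu,(\cdot,\cdot)}$ at $0$, so $F(\mu)$ is the square norm of its Ricci tensor. The function $F:V_n\to\mathbb{R}$ is a polynomial, and its gradient is taken with respect to the inner product on $V_n$ given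 by $(\mu,\lambda)=\sum_{i,j}(\mu(e_i,e_j),\lambda(e_i,e_j))$ (sum over all ordered pairs). *)

(* Defs.v *)
From mathcomp Require Import all_boot all_order all_algebra.
From mathcomp Require Import all_classical all_reals all_analysis.
Set Implicit Arguments.
Unset Strict Implicit.
Unset Printing Implicit Defensive.
Import Order.TTheory GRing.Theory Num.Theory.
Import numFieldNormedType.Exports.
Local Open Scope classical_set_scope.
Local Open Scope ring_scope.

(* R^n is 'cV[R]_n.  Operators are matrices acting on columns, and inner
   products are represented by their Gram matrices in the standard basis. *)

Section Calculus.
Variables (R : realType) (n : nat).

Definition stdv (i : 'I_n) : 'cV[R]_n := delta_mx i 0.

Definition partial (i : 'I_n) (f : 'cV[R]_n -> R) : 'cV[R]_n -> R :=
  fun x => 'D_(stdv i) f x.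

(* C^oo: all iterated partial derivatives exist and are differentiable. *)
Definition smooth (f : 'cV[R]_n -> R) :=
  forall (s : seq 'I_n) (x : 'cV[R]_n), differentiable (foldr partial f s) x.

Definition jacobian_mx (f : 'cV[R]_n -> 'cV[R]_n) (x : 'cV[R]_n) : 'M[R]_n :=
  \matrix_(k, j) partial j (fun y => f y k 0) x.

(* The derivative at t, relative to J, of a curve f defined on J; it is the
   one-sided derivative when t is an endpoint of the interval J. *)
Definition deriv_within (V : normedModType R) (J : set R) (f : R -> V)
    (t : R) (l : V) :=
  (s - t)^-1 *: (f s - f t) @[s --> within J t^'] --> l.

End Calculus.

Section InnerProduct.
Variables (R : realType) (n : nat).

Definition inner_product (Q : 'M[R]_n) :=
  Q^T = Q /\ forall u : 'cV[R]_n, u != 0 -> 0 < (u^T *m Q *m u) 0 0.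

Definition ip (Q : 'M[R]_n) (u v : 'cV[R]_n) : R := (u^T *m Q *m v) 0 0.

Definition orthonormal_basis (Q : 'M[R]_n) (e : 'I_n -> 'cV[R]_n) :=
  forall i j, ip Q (e i) (e j) = (i == j)%:R.

(* Transpose with respect to Q: ip Q (A u) v = ip Q u (transp Q A v). *)
Definition transp (Q A : 'M[R]_n) : 'M[R]_n := invmx Q *m A^T *m Q.

End InnerProduct.

Section LieAlgebra.
Variables (R : realType) (n : nat).

Definition bracket := 'cV[R]_n -> 'cV[R]_n -> 'cV[R]_n.
Implicit Types mu lam : bracket.

(* Membership in V_n. *)
Definition skew_bilinear mu :=
  [/\ forall x, linear (mu x),
      forall y, linear (fun x => mu x y) &
      forall x y, mu x y = - mu y x].

Definition jacobi_identity mu :=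
  forall x y z, mu x (mu y z) + mu y (mu z x) + mu z (mu x y) = 0.

(* lower_central mu k is the k-th term of the lower central series: the whole
   space for k = 0, and the span of mu(x, y), with y in the k-th term, for
   k + 1. *)
Inductive lower_central mu : nat -> 'cV[R]_n -> Prop :=
| LcsTop x : lower_central mu 0 x
| LcsBracket k x y : lower_central mu k y -> lower_central mu k.+1 (mu x y)
| LcsAdd k x y : lower_central mu k x -> lower_central mu k y ->
    lower_central mu k (x + y)
| LcsScale k a x : lower_central mu k x -> lower_central mu k (a *: x).

Definition nilpotent_bracket mu :=
  exists k, forall x, lower_central mu k x -> x = 0.

(* Membership in N_n. *)
Definition nilpotent_lie mu :=
  [/\ skew_bilinear mu, jacobi_identity mu & nilpotent_bracket mu].

Definition ad_mx mu (x : 'cV[R]_n) : 'M[R]_n :=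
  \matrix_(k, j) mu x (stdv R j) k 0.

End LieAlgebra.

Section BakerCampbellHausdorff.
Variables (R : realType) (n : nat) (mu : bracket R n).

(* [w_1, [w_2, ... [w_(d-1), w_d]]] *)
Fixpoint nested_bracket (w : seq 'cV[R]_n) : 'cV[R]_n :=
  match w with
  | [::] => 0
  | [:: x] => x
  | x :: w' => mu x (nested_bracket w')
  end.

(* The word x^r_1 y^s_1 ... x^r_m y^s_m, with (r_i, s_i) = p i. *)
Definition bch_word d m (p : {ffun 'I_m -> 'I_d.+1 * 'I_d.+1})
    (x y : 'cV[R]_n) : seq 'cV[R]_n :=
  flatten [seq nseq (p i).1 x ++ nseq (p i).2 y | i <- enum 'I_m].

(* The part of degree d of Dynkin's form of the formula,
     \sum_m (-1)^(m-1) / m \sum_(r, s)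
       [x^r_1 y^s_1 ... x^r_m y^s_m] / (d * \prod_i r_i! s_i!),
   where r_i + s_i > 0 for all i <= m and \sum_i (r_i + s_i) = d. *)
Definition bch_term (x y : 'cV[R]_n) (d : nat) : 'cV[R]_n :=
  \sum_(1 <= m < d.+1)
   \sum_(p : {ffun 'I_m -> 'I_d.+1 * 'I_d.+1} |
         [forall i, 0 < (p i).1 + (p i).2]%N &&
         (\sum_i ((p i).1 + (p i).2) == d)%N)
     ((-1) ^+ m.-1 / (m%:R * d%:R * \prod_i ((p i).1`! * (p i).2`!)%:R))
       *: nested_bracket (bch_word p x y).

(* The group law; the series is a finite sum when mu is nilpotent. *)
Definition bch (x y : 'cV[R]_n) : 'cV[R]_n :=
  limn (fun N => \sum_(0 <= d < N) bch_term x y d).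

End BakerCampbellHausdorff.

Section Riemannian.
Variables (R : realType) (n : nat).

(* g x is the Gram matrix of the metric at x in the frame of the standard
   coordinate vector fields. *)
Definition metric := 'cV[R]_n -> 'M[R]_n.
Implicit Types g : metric.

Definition riemannian_metric g :=
  (forall x, inner_product (g x)) /\ forall i j, smooth (fun x => g x i j).

(* f^* g *)
Definition pullback (f : 'cV[R]_n -> 'cV[R]_n) g : metric :=
  fun x => (jacobian_mx f x)^T *m g (f x) *m jacobian_mx f x.

Definition left_invariant (mu : bracket R n) g :=
  forall x, pullback (bch mu x) g = g.

(* g_(mu, Q): its value at x is the pullback of Q by the differential at x of
   the left translation by the inverse of x, which is - x because the group is
   identified with its Lie algebra via the exponential map. *)
Definition left_invariant_metric (mu : bracket R n) (Q : 'M[R]_n) : metric :=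
  fun x => pullback (bch mu (- x)) (fun=> Q) x.

Definition christoffel g (k i j : 'I_n) : 'cV[R]_n -> R := fun x =>
  2^-1 * \sum_l invmx (g x) k l *
    (partial i (fun y => g y j l) x + partial j (fun y => g y i l) x
     - partial l (fun y => g y i j) x).

(* The coefficient of d_l in R(d_i, d_j) d_k, where
   R(X, Y) = [nabla_X, nabla_Y] - nabla_[X, Y]. *)
Definition riemann g (i j k l : 'I_n) : 'cV[R]_n -> R := fun x =>
  partial i (christoffel g l j k) x - partial j (christoffel g l i k) x
  + \sum_m (christoffel g m j k x * christoffel g l i m x
            - christoffel g m i k x * christoffel g l j m x).

(* Rc(Y, Z) is the trace of X |-> R(X, Y) Z. *)
Definition ricci_tensor g (x : 'cV[R]_n) : 'M[R]_n :=
  \matrix_(j, k) \sum_i riemann g i j k i x.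

(* The operator Ric such that g(Ric u, v) = Rc(u, v). *)
Definition ricci_operator g (x : 'cV[R]_n) : 'M[R]_n :=
  invmx (g x) *m ricci_tensor g x.

Definition ricci_flow (J : set R) (g : R -> metric) :=
  (forall t, J t -> riemannian_metric (g t)) /\
  forall t x, J t ->
    deriv_within J (fun s => g s x) t (- 2 *: ricci_tensor (g t) x).

End Riemannian.

Section GradientFlow.
Variables (R : realType) (n : nat) (Q : 'M[R]_n) (e : 'I_n -> 'cV[R]_n).
Implicit Types mu lam G : bracket R n.

Definition Ric mu : 'M[R]_n :=
  - 2^-1 *: (\sum_i transp Q (ad_mx mu (e i)) *m ad_mx mu (e i))
  + 4^-1 *: (\sum_i ad_mx mu (e i) *m transp Q (ad_mx mu (e i))).

Definition F mu : R := \tr (Ric mu *m Ric mu).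

Definition bracket_ip mu lam : R :=
  \sum_i \sum_j ip Q (mu (e i) (e j)) (lam (e i) (e j)).

(* G is the gradient at mu of the polynomial function f on V_n. *)
Definition is_gradient (f : bracket R n -> R) mu G :=
  skew_bilinear G /\
  forall lam, skew_bilinear lam ->
    is_derive (0 : R) (1 : R) (fun s : R => f (fun x y => mu x y + s *: lam x y))
      (bracket_ip G lam).

(* A curve in V_n solving mu' = - grad F on J with initial value mu0; as V_n
   is finite dimensional, derivatives in V_n are pointwise derivatives. *)
Definition neg_gradient_flow (J : set R) mu0 (mu : R -> bracket R n) :=
  [/\ forall t, J t -> skew_bilinear (mu t),
      forall t, J t -> exists2 G, is_gradient F (mu t) G &
        forall x y, deriv_within J (fun s => mu s x y) t (- G x y) &
      mu 0 = mu0].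

End GradientFlow.

(* Main.v *)
Require Import Defs.
From mathcomp Require Import all_boot all_order all_algebra.
From mathcomp Require Import all_classical all_reals all_analysis.
From mathcomp Require Import ring lra.
Import Order.TTheory GRing.Theory Num.Theory.
Import numFieldNormedType.Exports.
Set Implicit Arguments.
Unset Strict Implicit.
Unset Printing Implicit Defensive.
Local Open Scope classical_set_scope.
Local Open Scope ring_scope.

(** The flow is mu(t) = h(t) . mu0, for the change-of-basis action of GL_n on V_n.
    The two evolution equations give (h^-T g(0) h^-1)' = 0, hence
    g(t)(0) = h(t)^T Q h(t); with left invariance and the naturality of the
    Baker-Campbell-Hausdorff series this is (h^-1)^* g(t) = g_(mu(t), Q).

    The Ricci operator of a left-invariant metric at 0 depends on the 2-jet of
    g(x) = J(x)^T g(0) J(x), where J(x) is the differential of left translation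
    by -x.  The terms of degree at most 3 of Dynkin's formula give
    J(x) = 1 - ad x / 2 + (ad x)^2 / 6 + O(x^3), and nilpotency removes the
    contributions of tr (ad x) and tr (ad x ad y); what is left is Ric_mu.

    It follows that mu' = - pi(Ric_mu) mu, where pi is the infinitesimal action
    of gl_n on V_n.  Since tr (Ric_mu A) = (pi(A) mu, mu) / 4, the gradient of
    F is pi(Ric_mu) mu.  Uniqueness is Gronwall's inequality. *)

(** * Derivatives relative to a set *)

(** The Ricci tensor is defined by coordinate derivatives of [g], whereas [Ric] is an algebraic
    expression in the bracket; most of the work links the two. Nilpotency makes the
    Baker-Campbell-Hausdorff map polynomial, so O(x^3) can mean membership in the cube of the ideal
    of the origin. A differentiation lowers this order by at most one, and no estimate of a
    remainder is involved. The identity for tr (Ric_mu A) yields the gradient by polarization: for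
    self-adjoint A the operator pi(A) is symmetric, so the derivative of mu |-> tr (Ric_mu A) in the
    direction lam is (pi(A) mu, lam) / 2. As dF(lam) = 2 tr (Ric_mu dRic_mu(lam)), taking A =
    Ric_mu, which is self-adjoint, gives (pi(Ric_mu) mu, lam). The map h(t) is an isometry from
    g(t)(0) to Q and carries mu0 to mu(t). It therefore conjugates the Ricci operator of g(t) at 0
    into Ric_mu(t), and the equation for h reads h' h^-1 = - Ric_mu(t). The flow lives on an
    arbitrary interval J containing 0, with one-sided derivatives at end points; the differential
    calculus is therefore set up relative to J, and its case J = R also serves for partial
    derivatives. *)

Section RelativeDerivative.
Variables (R : realType) (J : set R).

(** The scalar case of [deriv_within], with multiplication in place of scaling so that [ring]
    handles difference quotients; curves of matrices are differentiated entry by entry. *)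
Definition dwithin (f : R -> R) (t l : R) :=
  (s - t)^-1 * (f s - f t) @[s --> within J t^'] --> l.

Lemma dwithin_ext f g t l : f =1 g -> dwithin f t l -> dwithin g t l.
Proof. by move=> /funext ->. Qed.

Lemma near_within_neq t : \forall s \near within J t^', J s /\ s != t.
Proof.
by rewrite /within /= near_withinE; near=> s => Js; split => //;
  near: s; exact: nbhs_dnbhs_neq.
Unshelve. all: by end_near. Qed.

Lemma cvg_within_eq (f g : R -> R) (t l : R) : (forall s, J s -> s != t -> f s = g s) ->
  f s @[s --> within J t^'] --> l -> g s @[s --> within J t^'] --> l.
Proof.
move=> fg; apply: cvg_trans; apply: near_eq_cvg; near=> s.
have [Js st] : J s /\ s != t by near: s; exact: near_within_neq.
exact: fg.
Unshelve. all: by end_near. Qed.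

Lemma dwithin_cvg f t l : dwithin f t l -> f s @[s --> within J t^'] --> f t.
Proof.
move=> fl.
have H : f t + (s - t) * ((s - t)^-1 * (f s - f t)) @[s --> within J t^']
    --> f t + (t - t) * l.
  apply: cvgD; first exact: cvg_cst.
  apply: cvgM => //; apply: cvgB; last exact: cvg_cst.
  by move=> A /nbhs_dnbhs; exact: cvg_within.
rewrite subrr mul0r addr0 in H.
apply: cvg_within_eq H => s _ st.
by rewrite mulrA mulfV ?subr_eq0// mul1r addrC subrK.
Qed.

Lemma dwithin_cst c t : dwithin (fun=> c) t 0.
Proof.
rewrite /dwithin; under eq_fun do rewrite subrr mulr0.
exact: cvg_cst.
Qed.

Lemma dwithin_id t : dwithin id t 1.
Proof.
apply: (@cvg_within_eq (fun=> 1)); last exact: cvg_cst.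
move=> s _ st.
by rewrite mulVf ?subr_eq0.
Qed.

Lemma dwithin_add f g t l m : dwithin f t l -> dwithin g t m -> dwithin (fun s => f s + g s) t (l + m).
Proof.
move=> fl gm; apply: cvg_within_eq (cvgD fl gm) => s _ _ /=.
by rewrite -mulrDr opprD addrACA.
Qed.

Lemma dwithin_mul f g t l m : dwithin f t l -> dwithin g t m ->
  dwithin (fun s => f s * g s) t (l * g t + f t * m).
Proof.
move=> fl gm.
have H : (s - t)^-1 * (f s - f t) * g s + f t * ((s - t)^-1 * (g s - g t))
    @[s --> within J t^'] --> l * g t + f t * m.
  by apply: cvgD; apply: cvgM => //; [exact: dwithin_cvg gm|exact: cvg_cst].
by apply: cvg_within_eq H => s _ _ /=; ring.
Qed.

Lemma dwithin_scale c f t l : dwithin f t l -> dwithin (fun s => c * f s) t (c * l).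
Proof. by move=> fl; have := dwithin_mul (dwithin_cst c t) fl; rewrite mul0r add0r. Qed.

Arguments dwithin_scale c {f t l}.

Lemma dwithin_opp f t l : dwithin f t l -> dwithin (fun s => - f s) t (- l).
Proof.
move=> /(dwithin_scale (-1)); rewrite mulN1r; apply: dwithin_ext => s; exact: mulN1r.
Qed.

Lemma dwithin_sub f g t l m : dwithin f t l -> dwithin g t m -> dwithin (fun s => f s - g s) t (l - m).
Proof. by move=> fl /dwithin_opp; exact: dwithin_add. Qed.

Lemma dwithin_sum (I : Type) (r : seq I) (P : pred I) (f : I -> R -> R) t (l : I -> R) :
  (forall i, P i -> dwithin (f i) t (l i)) ->
  dwithin (fun s => \sum_(i <- r | P i) f i s) t (\sum_(i <- r | P i) l i).
Proof.
move=> H; elim: r => [|i r IH].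
  by rewrite big_nil; apply: dwithin_ext (dwithin_cst 0 t) => s; rewrite big_nil.
rewrite big_cons; case: ifP => Pi.
  by apply: dwithin_ext (dwithin_add (H i Pi) IH) => s; rewrite big_cons Pi.
by apply: dwithin_ext IH => s; rewrite big_cons Pi.
Qed.

Definition dwithinmx m n (A : R -> 'M[R]_(m, n)) (t : R) (L : 'M[R]_(m, n)) :=
  forall i j, dwithin (fun s => A s i j) t (L i j).

(** A neighbourhood of a matrix contains a product of neighbourhoods of its entries, and finitely
    many eventual conditions hold simultaneously. *)
Lemma deriv_withinP m n (A : R -> 'M[R]_(m, n)) t L :
  deriv_within J A t L <-> dwithinmx A t L.
Proof.
split=> [AL i j|AL].
  have := @continuous_cvg _ _ _ _ _ _ (fun M : 'M[R]_(m, n) => M i j) L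
    (@coord_continuous _ _ _ _ _ _) AL.
  have -> : dwithin (fun s => A s i j) t (L i j) =
      ((((s - t)^-1 *: (A s - A t)) : 'M[R]_(m, n)) i j @[s --> within J t^']
        --> L i j).
    by rewrite /dwithin; under [in RHS]eq_fun do rewrite !mxE.
  exact.
move=> /= B [P PL sPB].
have : \forall s \near within J t^', forall i j,
    P i j ((s - t)^-1 * (A s i j - A t i j)).
  apply: filter_forall => i; apply: filter_forall => j.
  exact: (AL i j _ (PL i j)).
rewrite near_simpl; apply: filterS => s Ps; apply: sPB => i j.
by rewrite !mxE; exact: Ps.
Qed.

Lemma dwithinmx_ext m n (A B : R -> 'M[R]_(m, n)) t L :
  A =1 B -> dwithinmx A t L -> dwithinmx B t L.
Proof. by move=> /funext ->. Qed.

Lemma dwithinmx_cst m n (A : 'M[R]_(m, n)) t : dwithinmx (fun=> A) t 0.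
Proof. by move=> i j; rewrite mxE; exact: dwithin_cst. Qed.

Lemma dwithinmx_add m n (A B : R -> 'M[R]_(m, n)) t L M :
  dwithinmx A t L -> dwithinmx B t M -> dwithinmx (fun s => A s + B s) t (L + M).
Proof.
move=> AL BM i j; rewrite mxE; apply: dwithin_ext (dwithin_add (AL i j) (BM i j)) => s.
by rewrite mxE.
Qed.

Lemma dwithinmx_scale m n c (A : R -> 'M[R]_(m, n)) t L :
  dwithinmx A t L -> dwithinmx (fun s => c *: A s) t (c *: L).
Proof.
move=> AL i j; rewrite mxE; apply: dwithin_ext (dwithin_scale c (AL i j)) => s.
by rewrite mxE.
Qed.

Arguments dwithinmx_scale {m n} c {A t L}.

Lemma dwithinmx_sum m n (I : Type) (r : seq I) (P : pred I)
    (A : I -> R -> 'M[R]_(m, n)) t L :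
  (forall i, P i -> dwithinmx (A i) t (L i)) ->
  dwithinmx (fun s => \sum_(i <- r | P i) A i s) t (\sum_(i <- r | P i) L i).
Proof.
move=> H i j; rewrite summxE.
apply: dwithin_ext (dwithin_sum (r := r) (fun k Pk => H k Pk i j)) => s.
by rewrite summxE.
Qed.

Lemma dwithinmx_mul m n p (A : R -> 'M[R]_(m, n)) (B : R -> 'M[R]_(n, p)) t L M :
  dwithinmx A t L -> dwithinmx B t M ->
  dwithinmx (fun s => A s *m B s) t (L *m B t + A t *m M).
Proof.
move=> AL BM i j; rewrite !mxE -big_split /=.
apply: dwithin_ext (dwithin_sum (fun k _ => dwithin_mul (AL i k) (BM k j))) => s.
by rewrite mxE.
Qed.

Lemma dwithinmx_mull m n p (A : 'M[R]_(m, n)) (B : R -> 'M[R]_(n, p)) t M :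
  dwithinmx B t M -> dwithinmx (fun s => A *m B s) t (A *m M).
Proof. by move=> /(dwithinmx_mul (dwithinmx_cst A t)); rewrite mul0mx add0r. Qed.

Lemma dwithinmx_mulr m n p (A : R -> 'M[R]_(m, n)) (B : 'M[R]_(n, p)) t L :
  dwithinmx A t L -> dwithinmx (fun s => A s *m B) t (L *m B).
Proof. by move=> /dwithinmx_mul/(_ (dwithinmx_cst B t)); rewrite mulmx0 addr0. Qed.

Lemma dwithinmx_tr m n (A : R -> 'M[R]_(m, n)) t L :
  dwithinmx A t L -> dwithinmx (fun s => (A s)^T) t L^T.
Proof.
by move=> AL i j; rewrite mxE; apply: dwithin_ext (AL j i) => s; rewrite mxE.
Qed.

Lemma dwithin_mxtrace n (A : R -> 'M[R]_n) t L :
  dwithinmx A t L -> dwithin (fun s => \tr (A s)) t (\tr L).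
Proof. by move=> AL; apply: dwithin_sum => i _; exact: AL. Qed.

Let W t := within J t^'.

Lemma cvg_sum_within (I : Type) (r : seq I) (P : pred I) (f : I -> R -> R) t
    (l : I -> R) : (forall i, P i -> f i s @[s --> W t] --> l i) ->
  \sum_(i <- r | P i) f i s @[s --> W t] --> \sum_(i <- r | P i) l i.
Proof.
move=> H; elim: r => [|i r IH].
  by rewrite big_nil; under eq_fun do rewrite big_nil; exact: cvg_cst.
rewrite big_cons; under eq_fun do rewrite big_cons.
by case: ifP => // Pi; apply: cvgD => //; exact: H.
Qed.

Lemma cvg_prod_within (I : Type) (r : seq I) (P : pred I) (f : I -> R -> R) t
    (l : I -> R) : (forall i, P i -> f i s @[s --> W t] --> l i) ->
  \prod_(i <- r | P i) f i s @[s --> W t] --> \prod_(i <- r | P i) l i.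
Proof.
move=> H; elim: r => [|i r IH].
  by rewrite big_nil; under eq_fun do rewrite big_nil; exact: cvg_cst.
rewrite big_cons; under eq_fun do rewrite big_cons.
by case: ifP => // Pi; apply: cvgM => //; exact: H.
Qed.

Lemma cvg_det_within n (A : R -> 'M[R]_n) t (L : 'M[R]_n) :
  (forall i j, A s i j @[s --> W t] --> L i j) ->
  \det (A s) @[s --> W t] --> \det L.
Proof.
move=> H; apply: cvg_sum_within => p _; apply: cvgM; first exact: cvg_cst.
by apply: cvg_prod_within => i _; exact: H.
Qed.

(** Cramer's rule makes the inverse a quotient of polynomials in the entries. Invertibility is asked
    along all of J because [invmx] returns a singular matrix unchanged. *)
Lemma cvg_invmx_within n (A : R -> 'M[R]_n) t :
  (forall i j, A s i j @[s --> W t] --> A t i j) ->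
  (forall s, J s -> A s \in unitmx) -> A t \in unitmx ->
  forall i j, invmx (A s) i j @[s --> W t] --> invmx (A t) i j.
Proof.
move=> H U Ut i j.
have -> : invmx (A t) i j = (\det (A t))^-1 * cofactor (A t) j i.
  by rewrite /invmx Ut !mxE.
have : (\det (A s))^-1 * cofactor (A s) j i @[s --> W t]
    --> (\det (A t))^-1 * cofactor (A t) j i.
  apply: cvgM.
    apply: cvgV; last exact: cvg_det_within.
    by move: Ut; rewrite unitmxE unitfE.
  apply: cvgM; first exact: cvg_cst.
  apply: cvg_det_within => k l; rewrite !mxE.
  by under eq_fun do rewrite !mxE; exact: H.
move=> K; apply: cvg_within_eq K => s Js _.
by rewrite /invmx U // !mxE.
Qed.

(** From A(s)^-1 - A(t)^-1 = - A(s)^-1 (A(s) - A(t)) A(t)^-1, where the first factor is only known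
    to be continuous. *)
Lemma dwithinmx_invmx n (A : R -> 'M[R]_n) t L :
  (forall s, J s -> A s \in unitmx) -> A t \in unitmx ->
  dwithinmx A t L ->
  dwithinmx (fun s => invmx (A s)) t (- (invmx (A t) *m L *m invmx (A t))).
Proof.
move=> U Ut AL i j.
have : (- \sum_k (\sum_l invmx (A s) i l * ((s - t)^-1 * (A s l k - A t l k)))
    * invmx (A t) k j) @[s --> W t]
    --> (- (invmx (A t) *m L *m invmx (A t))) i j.
  rewrite mxE; apply: cvgN; rewrite mxE; apply: cvg_sum_within => k _.
  apply: cvgM; last exact: cvg_cst.
  rewrite mxE; apply: cvg_sum_within => l _.
  apply: cvgM; last exact: AL.
  apply: cvg_invmx_within => // a b; exact: dwithin_cvg (AL a b).
move=> K; apply: cvg_within_eq K => s Js _.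
have -> : invmx (A s) i j - invmx (A t) i j =
    (- (invmx (A s) *m (A s - A t) *m invmx (A t))) i j.
  rewrite mulmxBr mulmxBl mulVmx ?U// mul1mx -mulmxA mulmxV// mulmx1.
  by rewrite opprB !mxE.
rewrite mxE mulrN; congr (- _).
rewrite mxE mulr_sumr; apply: eq_bigr => k _; rewrite mulrA; congr (_ * _).
by rewrite mxE mulr_sumr; apply: eq_bigr => l _; rewrite !mxE; ring.
Qed.

End RelativeDerivative.

Arguments dwithin_scale {R J} c {f t l}.
Arguments dwithinmx_scale {R J m n} c {A t L}.
Arguments dwithinmx_mull {R J m n p} A {B t M}.
Arguments dwithinmx_mulr {R J m n p A} B {t L}.

(** * Directional derivatives as derivatives along lines *)

Section Directional.
Variables (R : realType) (V : normedModType R).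

Lemma is_derive_dwithin (f : V -> R) (x v : V) (l : R) :
  is_derive x v f l <-> dwithin setT (fun s => f (s *: v + x)) 0 l.
Proof.
have E : dwithin setT (fun s => f (s *: v + x)) 0 l =
    (h^-1 *: ((f \o shift x) (h *: v) - f x) @[h --> (0 : R)^'] --> l).
  rewrite /dwithin (_ : within setT 0^' = (0 : R)^'); last first.
    rewrite eqEsubset; split => A /=; rewrite /within /= => h.
      by apply: filterS h => s; apply.
    by apply: filterS h => s As _.
  by under eq_fun do rewrite subr0 scale0r add0r.
rewrite E; split=> [[fl <-]|fl]; first exact: fl.
split; first by apply: cvgP fl.
exact: cvg_lim fl.
Qed.

Lemma derive_dwithin (f : V -> R) (x v : V) : derivable f x v ->
  dwithin setT (fun s => f (s *: v + x)) 0 ('D_v f x).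
Proof. by move=> fx; apply/is_derive_dwithin; exact/derivableP. Qed.

Lemma dwithin_derive (f : V -> R) (x v : V) (l : R) :
  dwithin setT (fun s => f (s *: v + x)) 0 l -> 'D_v f x = l.
Proof. by move=> /is_derive_dwithin[]. Qed.

End Directional.

(** * Polynomial functions vanishing at the origin *)

Section VanishingOrder.
Variables (R : realType) (n : nat).
Implicit Types f g : 'cV[R]_n -> R.

(* [van k] is the k-th power of the ideal of the origin in the ring of
   polynomial functions. *)
Inductive van : nat -> ('cV[R]_n -> R) -> Prop :=
| van_cst c : van 0 (fun=> c)
| van0 k : van k (fun=> 0)
| vanX k i f : van k f -> van k.+1 (fun x => x i 0 * f x)
| vanD k f g : van k f -> van k g -> van k (fun x => f x + g x)
| van_pred k f : van k.+1 f -> van k f.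

Lemma van_ext k f g : f =1 g -> van k f -> van k g.
Proof. by move=> /funext ->. Qed.

Lemma van_le j k f : (j <= k)%N -> van k f -> van j f.
Proof.
move=> jk; rewrite -(subnK jk); elim: (k - j)%N => // m IH.
by rewrite addSn => /van_pred.
Qed.

Lemma van_coord i : van 1 (fun x => x i 0).
Proof. by apply: van_ext (vanX i (van_cst 1)) => x; rewrite mulr1. Qed.

Lemma vanZ k c f : van k f -> van k (fun x => c * f x).
Proof.
elim=> {k f}.
- by move=> d; exact: van_cst.
- by move=> k; apply: van_ext (van0 k) => x; rewrite mulr0.
- by move=> k i f _ IH; apply: van_ext (vanX i IH) => x; rewrite mulrCA.
- by move=> k f g _ IHf _ IHg; apply: van_ext (vanD IHf IHg) => x; rewrite mulrDr.
- by move=> k f _; exact: van_pred.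
Qed.

Lemma vanM j k f g : van j f -> van k g -> van (j + k) (fun x => f x * g x).
Proof.
move=> + gk; elim=> {j f}.
- by move=> c; exact: vanZ.
- by move=> j; apply: van_ext (van0 _) => x; rewrite mul0r.
- by move=> j i f _ IH; apply: van_ext (vanX i IH) => x; rewrite mulrA.
- by move=> j f h _ IHf _ IHh; apply: van_ext (vanD IHf IHh) => x; rewrite mulrDl.
- by move=> j f _; exact: van_pred.
Qed.

Lemma vanN k f : van k f -> van k (fun x => - f x).
Proof. by move=> /(vanZ (-1)); apply: van_ext => x; rewrite mulN1r. Qed.

Lemma van_sum k (I : Type) (r : seq I) (P : pred I) (f : I -> 'cV[R]_n -> R) :
  (forall i, P i -> van k (f i)) -> van k (fun x => \sum_(i <- r | P i) f i x).
Proof.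
move=> H; elim: r => [|i r IH].
  by apply: van_ext (van0 k) => x; rewrite big_nil.
case: (boolP (P i)) => Pi.
  by apply: van_ext (vanD (H i Pi) IH) => x; rewrite big_cons Pi.
by apply: van_ext IH => x; rewrite big_cons (negbTE Pi).
Qed.

Lemma van_at0 k f : van k.+1 f -> f 0 = 0.
Proof.
move=> fk; suff : (0 < k.+1)%N -> f 0 = 0 by exact.
elim: fk => //.
- by move=> j i g _ _ _; rewrite mxE mul0r.
- by move=> j g h _ IHg _ IHh j0; rewrite IHg // IHh // addr0.
- by move=> j g _ IH _; exact: IH.
Qed.

Lemma van_differentiable k f x : van k f -> differentiable f x.
Proof.
elim=> {k f}.
- by move=> c; exact: differentiable_cst.
- by move=> k; exact: differentiable_cst.
- move=> k i f _ IH.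
  exact: (differentiableM (differentiable_coord x i 0) IH).
- by move=> k f g _ IHf _ IHg; exact: (differentiableD IHf IHg).
- by [].
Qed.

Lemma van_derivable k f x v : van k f -> derivable f x v.
Proof. by move=> fk; apply: diff_derivable; exact: van_differentiable fk. Qed.

Arguments van_derivable {k f} x v.

Lemma dwithin_coord i (x v : 'cV[R]_n) :
  dwithin setT (fun s => (s *: v + x) i 0) 0 (v i 0).
Proof.
have := dwithin_add (dwithin_mul (dwithin_id setT 0) (dwithin_cst setT (v i 0) 0))
  (dwithin_cst setT (x i 0) 0).
by rewrite mul1r mulr0 !addr0; apply: dwithin_ext => s; rewrite !mxE.
Qed.

(** Leibniz's rule on the generators. A remainder of order 3 thus has first and second derivatives
    that vanish at the origin, which is how remainders leave the curvature computation. *)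
Lemma van_derive k f v : van k f -> van k.-1 (fun x => 'D_v f x).
Proof.
elim=> {k f}.
- move=> c; apply: van_ext (van0 0) => x.
  by rewrite (dwithin_derive (f := fun _ : 'cV[R]_n => c) (dwithin_cst _ c _)).
- move=> k; apply: van_ext (van0 _) => x.
  by rewrite (dwithin_derive (f := fun _ : 'cV[R]_n => 0) (dwithin_cst _ 0 _)).
- move=> k i f fk IH.
  have fx x : 'D_v (fun x : 'cV[R]_n => x i 0 * f x) x =
      v i 0 * f x + x i 0 * 'D_v f x.
    have H := dwithin_mul (@dwithin_coord i x v) (derive_dwithin (van_derivable x v fk)).
    by rewrite (dwithin_derive (f := fun x : 'cV[R]_n => x i 0 * f x) H) scale0r add0r.
  apply: (@van_ext _ (fun x => v i 0 * f x + x i 0 * 'D_v f x)) => //.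
  apply: vanD; first exact: vanZ.
  (* For k = 0 the predecessor truncates, and the factor [x i 0] gives one order more than is
     asked. *)
  by case: k fk IH => [|k] fk IH; [exact: van_pred (vanX i IH)|exact: vanX].
- move=> k f g fk IHf gk IHg; apply: van_ext (vanD IHf IHg) => x.
  have H := dwithin_add (derive_dwithin (van_derivable x v fk)) (derive_dwithin (van_derivable x v gk)).
  by rewrite (dwithin_derive (f := fun x : 'cV[R]_n => f x + g x) H).
- by move=> k f _; case: k => // k; exact: van_pred.
Qed.

Definition vanm k p q (A : 'cV[R]_n -> 'M[R]_(p, q)) :=
  forall i j, van k (fun x => A x i j).

Lemma vanm_ext k p q (A B : 'cV[R]_n -> 'M[R]_(p, q)) :
  A =1 B -> vanm k A -> vanm k B.
Proof. by move=> /funext ->. Qed.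

Lemma vanm_le j k p q (A : 'cV[R]_n -> 'M[R]_(p, q)) :
  (j <= k)%N -> vanm k A -> vanm j A.
Proof. by move=> jk Ak a b; exact: van_le (Ak a b). Qed.

Lemma vanm_cst p q (A : 'M[R]_(p, q)) : vanm 0 (fun=> A).
Proof. by move=> i j; exact: van_cst. Qed.

Lemma vanm_id : vanm 1 id.
Proof. by move=> i j; rewrite (ord1 j); exact: van_coord. Qed.

Lemma vanmD k p q (A B : 'cV[R]_n -> 'M[R]_(p, q)) :
  vanm k A -> vanm k B -> vanm k (fun x => A x + B x).
Proof.
move=> Ak Bk i j; apply: van_ext (vanD (Ak i j) (Bk i j)) => x.
by rewrite mxE.
Qed.

Lemma vanmZ k c p q (A : 'cV[R]_n -> 'M[R]_(p, q)) :
  vanm k A -> vanm k (fun x => c *: A x).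
Proof.
by move=> Ak i j; apply: van_ext (vanZ c (Ak i j)) => x; rewrite mxE.
Qed.

Lemma vanmN k p q (A : 'cV[R]_n -> 'M[R]_(p, q)) :
  vanm k A -> vanm k (fun x => - A x).
Proof. by move=> Ak i j; apply: van_ext (vanN (Ak i j)) => x; rewrite mxE. Qed.

Lemma vanm_tr k p q (A : 'cV[R]_n -> 'M[R]_(p, q)) :
  vanm k A -> vanm k (fun x => (A x)^T).
Proof. by move=> Ak i j; apply: van_ext (Ak j i) => x; rewrite mxE. Qed.

Lemma vanmM j k p q r (A : 'cV[R]_n -> 'M[R]_(p, q))
    (B : 'cV[R]_n -> 'M[R]_(q, r)) :
  vanm j A -> vanm k B -> vanm (j + k) (fun x => A x *m B x).
Proof.
move=> Aj Bk a b.
have H : van (j + k) (fun x => \sum_c A x a c * B x c b).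
  by apply: van_sum => c _; exact: vanM.
by apply: van_ext H => x; rewrite mxE.
Qed.

Lemma vanm_sum k p q (I : Type) (r : seq I) (P : pred I)
    (A : I -> 'cV[R]_n -> 'M[R]_(p, q)) :
  (forall i, P i -> vanm k (A i)) -> vanm k (fun x => \sum_(i <- r | P i) A i x).
Proof.
move=> H a b.
have := van_sum r (fun i Pi => H i Pi a b).
by apply: van_ext => x; rewrite summxE.
Qed.

End VanishingOrder.

Arguments van_derivable {R n k f} x v.

(** * The Baker-Campbell-Hausdorff series *)

Section BracketAlgebra.
Variables (R : realType) (n : nat) (mu : bracket R n).
Hypothesis mu_V : skew_bilinear mu.

Lemma br_skew x y : mu x y = - mu y x. Proof. by case: mu_V. Qed.

Lemma brDr x y z : mu x (y + z) = mu x y + mu x z.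
Proof. by case: mu_V => H _ _; have := H x 1 y z; rewrite !scale1r. Qed.

Lemma br0r x : mu x 0 = 0.
Proof. by apply: (addrI (mu x 0)); rewrite -brDr !addr0. Qed.

Lemma brZr a x y : mu x (a *: y) = a *: mu x y.
Proof. by case: mu_V => H _ _; have := H x a y 0; rewrite br0r !addr0. Qed.

Lemma brNr x y : mu x (- y) = - mu x y.
Proof. by rewrite -scaleN1r brZr scaleN1r. Qed.

Lemma brDl x y z : mu (x + y) z = mu x z + mu y z.
Proof. by rewrite br_skew brDr opprD -!(br_skew _ z). Qed.

Lemma brZl a x y : mu (a *: x) y = a *: mu x y.
Proof. by rewrite br_skew brZr -scalerN -br_skew. Qed.

Lemma br0l x : mu 0 x = 0.
Proof. by rewrite br_skew br0r oppr0. Qed.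

Lemma brNl x y : mu (- x) y = - mu x y.
Proof. by rewrite -scaleN1r brZl scaleN1r. Qed.

Lemma brxx x : mu x x = 0.
Proof.
have /eqP := br_skew x x; rewrite -subr_eq0 opprK -mulr2n -scaler_nat.
by rewrite scaler_eq0 pnatr_eq0 /= => /eqP.
Qed.

Lemma br_sumr x (I : Type) (r : seq I) (P : pred I) f :
  mu x (\sum_(i <- r | P i) f i) = \sum_(i <- r | P i) mu x (f i).
Proof. exact: (big_morph (mu x) (brDr x) (br0r x)). Qed.

Lemma stdv_decomp (v : 'cV[R]_n) : v = \sum_i v i 0 *: stdv R i.
Proof.
by rewrite [LHS]matrix_sum_delta; apply: eq_bigr => i _; rewrite big_ord1.
Qed.

Lemma br_ad x y : mu x y = ad_mx mu x *m y.
Proof.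
rewrite {1}[y]stdv_decomp br_sumr; apply/colP => k; rewrite summxE mxE.
by apply: eq_bigr => j _; rewrite brZr !mxE mulrC.
Qed.

Lemma ad_stdv x j : col j (ad_mx mu x) = mu x (stdv R j).
Proof. by apply/colP => k; rewrite !mxE. Qed.

Lemma adD x y : ad_mx mu (x + y) = ad_mx mu x + ad_mx mu y.
Proof. by apply/matrixP => k j; rewrite !mxE brDl mxE. Qed.

Lemma adZ a x : ad_mx mu (a *: x) = a *: ad_mx mu x.
Proof. by apply/matrixP => k j; rewrite !mxE brZl mxE. Qed.

Lemma ad0 : ad_mx mu 0 = 0.
Proof. by apply/matrixP => k j; rewrite !mxE br0l mxE. Qed.

Lemma ad_sum (I : Type) (r : seq I) (P : pred I) f :
  ad_mx mu (\sum_(i <- r | P i) f i) = \sum_(i <- r | P i) ad_mx mu (f i).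
Proof. exact: (big_morph (ad_mx mu) adD ad0). Qed.

Lemma vanm_ad k (f : 'cV[R]_n -> 'cV[R]_n) :
  vanm k f -> vanm k (fun x => ad_mx mu (f x)).
Proof.
move=> fk; apply: (@vanm_ext _ _ _ _ _ (fun x => \sum_i f x i 0 *: ad_mx mu (stdv R i))).
  by move=> x; rewrite {2}[f x]stdv_decomp ad_sum; apply: eq_bigr => i _; rewrite adZ.
apply: vanm_sum => i _ a b.
apply: van_ext (vanZ (ad_mx mu (stdv R i) a b) (fk i 0)) => x.
by rewrite [RHS]mxE mulrC.
Qed.

Lemma vanm_br j k (f g : 'cV[R]_n -> 'cV[R]_n) :
  vanm j f -> vanm k g -> vanm (j + k) (fun x => mu (f x) (g x)).
Proof.
move=> /vanm_ad fj gk.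
by apply: vanm_ext (vanmM fj gk) => x; rewrite br_ad.
Qed.

Lemma dwithinmx_ad J (f : R -> 'cV[R]_n) t v :
  dwithinmx J f t v -> dwithinmx J (fun s => ad_mx mu (f s)) t (ad_mx mu v).
Proof.
move=> fv.
have E w : ad_mx mu w = \sum_i w i 0 *: ad_mx mu (stdv R i).
  by rewrite {1}[w]stdv_decomp ad_sum; apply: eq_bigr => i _; rewrite adZ.
rewrite E; apply: (dwithinmx_ext (fun s => esym (E (f s)))).
apply: dwithinmx_sum => i _ a b; rewrite mxE mulrC.
apply: dwithin_ext (dwithin_scale (ad_mx mu (stdv R i) a b) (fv i 0)) => s.
by rewrite [RHS]mxE mulrC.
Qed.

Lemma dwithinmx_br J (f g : R -> 'cV[R]_n) t v w :
  dwithinmx J f t v -> dwithinmx J g t w ->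
  dwithinmx J (fun s => mu (f s) (g s)) t (mu v (g t) + mu (f t) w).
Proof.
move=> /dwithinmx_ad fv gw; rewrite !(br_ad v, br_ad (f t)).
by apply: dwithinmx_ext (dwithinmx_mul fv gw) => s; rewrite br_ad.
Qed.

End BracketAlgebra.

(** * Dynkin's sum over a computable list of words *)

Section Words.
Variables (R : realType) (n : nat) (mu : bracket R n).

Definition letters (q : seq (nat * nat)) : seq bool :=
  flatten [seq nseq a.1 true ++ nseq a.2 false | a <- q].

Definition word (c : seq bool) (x y : 'cV[R]_n) := [seq if b then x else y | b <- c].

Definition pairs_of d m (p : {ffun 'I_m -> 'I_d.+1 * 'I_d.+1}) : seq (nat * nat) :=
  [seq ((p i).1 : nat, (p i).2 : nat) | i <- enum 'I_m].

Lemma bch_wordE d m (p : {ffun 'I_m -> 'I_d.+1 * 'I_d.+1}) x y :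
  bch_word p x y = word (letters (pairs_of p)) x y.
Proof.
rewrite /bch_word /word /letters /pairs_of map_flatten -!map_comp.
congr flatten; apply: eq_map => i /=.
by rewrite map_cat !map_nseq.
Qed.

Lemma size_letters q : size (letters q) = sumn [seq (a.1 + a.2)%N | a <- q].
Proof.
rewrite size_flatten /shape -map_comp; congr sumn; apply: eq_map => a /=.
by rewrite size_cat !size_nseq.
Qed.

Lemma sumn_pairs_of d m (p : {ffun 'I_m -> 'I_d.+1 * 'I_d.+1}) :
  sumn [seq (a.1 + a.2)%N | a <- pairs_of p] = (\sum_i ((p i).1 + (p i).2))%N.
Proof. by rewrite sumnE /pairs_of -map_comp big_map big_enum. Qed.

(** The exponents (r_i, s_i) as plain lists: unlike the finite functions of [bch_term], these can be
    enumerated by [vm_compute], which makes the terms of degree at most 3 explicit. *)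
Fixpoint pair_lists d m : seq (seq (nat * nat)) :=
  if m is m'.+1 then
    [seq a :: q | a <- [seq (i, j) | i <- iota 0 d.+1, j <- iota 0 d.+1],
                  q <- pair_lists d m']
  else [:: [::]].

Lemma mem_pair_lists d m q :
  (q \in pair_lists d m) =
  (size q == m) && all (fun a => (a.1 <= d)%N && (a.2 <= d)%N) q.
Proof.
elim: m q => [|m IH] [|a q]; rewrite ?mem_seq1 //.
  by apply/negbTE/negP => /allpairsP[[b r] [_ _]].
rewrite eqSS; apply/allpairsP/idP => [[[b r] [/allpairsP[[i j] []]]]|].
  rewrite !mem_iota /= !add0n !ltnS => id jd -> rm [-> ->] /=.
  by move: rm; rewrite IH id jd => /andP[-> ->].
move=> /andP[sm /andP[/andP[a1 a2] aq]]; exists (a, q); split => //; last by rewrite IH sm.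
apply/allpairsP; exists a; rewrite !mem_iota /= !add0n !ltnS a1 a2; split => //.
by case: a {a1 a2}.
Qed.

Lemma uniq_pair_lists d m : uniq (pair_lists d m).
Proof.
elim: m => // m IH; apply: allpairs_uniq => //.
  apply: allpairs_uniq; try exact: iota_uniq.
  by move=> [a b] [c e] _ _ [-> ->].
by move=> [a b] [c e] _ _ [-> ->].
Qed.

Lemma pairs_of_inj d m : injective (@pairs_of d m).
Proof.
move=> p p' /eq_in_map E; apply/ffunP => i.
have /E[] : i \in enum 'I_m by rewrite mem_enum.
by case: (p i) (p' i) => [a b] [c e] /= /val_inj -> /val_inj ->.
Qed.

Lemma pairs_of_mem d m :
  [seq pairs_of p | p <- index_enum {ffun 'I_m -> 'I_d.+1 * 'I_d.+1}]
    =i pair_lists d m.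
Proof.
move=> q; rewrite mem_pair_lists; apply/mapP/idP => [[p _ ->]|].
  rewrite size_map size_enum_ord eqxx /=; apply/allP => a /mapP[i _ ->] /=.
  by apply/andP; split; rewrite -ltnS ltn_ord.
move=> /andP[/eqP sm /allP aq].
exists [ffun i : 'I_m => (inord (nth (0, 0) q i).1, inord (nth (0, 0) q i).2)]%N.
  exact: mem_index_enum.
apply: (@eq_from_nth _ (0, 0)%N); first by rewrite size_map size_enum_ord.
move=> i; rewrite sm => im.
rewrite (nth_map (Ordinal im)) ?size_enum_ord// ffunE /=.
rewrite (nth_ord_enum _ (Ordinal im)).
have /andP[a1 a2] := aq _ (mem_nth (0, 0)%N (leq_trans im (eq_leq (esym sm)))).
by rewrite !inordK ?ltnS//; case: (nth _ q i) a1 a2.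
Qed.

(** Both index lists are duplicate-free and have the same members, hence are permutations of each
    other. *)
Lemma sum_pairs_of (V : nmodType) d m (P : pred (seq (nat * nat)))
    (f : seq (nat * nat) -> V) :
  \sum_(p : {ffun 'I_m -> 'I_d.+1 * 'I_d.+1} | P (pairs_of p)) f (pairs_of p) =
  \sum_(q <- [seq q <- pair_lists d m | P q]) f q.
Proof.
rewrite big_filter -(big_map (@pairs_of d m) P f); apply: perm_big.
apply: uniq_perm.
- by rewrite map_inj_uniq; [exact: index_enum_uniq|exact: pairs_of_inj].
- exact: uniq_pair_lists.
- exact: pairs_of_mem.
Qed.

Definition dynkin_pairs d m :=
  [seq q <- pair_lists d m | all (fun a => 0 < a.1 + a.2)%N q &&
                           (sumn [seq (a.1 + a.2)%N | a <- q] == d)].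

Definition dynkin_coef d m (q : seq (nat * nat)) : R :=
  (-1) ^+ m.-1 / (m%:R * d%:R * \prod_(a <- q) (a.1`! * a.2`!)%:R).

Lemma bch_termE x y d :
  bch_term mu x y d =
  \sum_(1 <= m < d.+1) \sum_(q <- dynkin_pairs d m)
    dynkin_coef d m q *: nested_bracket mu (word (letters q) x y).
Proof.
apply: eq_bigr => m _; rewrite -sum_pairs_of; apply: eq_big => [p|p _].
  rewrite sumn_pairs_of; congr (_ && _).
  apply/forallP/allP => [H a /mapP[i _ ->]|H i]; first exact: H.
  have /H // : ((p i).1 : nat, (p i).2 : nat) \in pairs_of p.
  by apply: (map_f (fun i => ((p i).1 : nat, (p i).2 : nat))); rewrite mem_enum.
rewrite bch_wordE /dynkin_coef; congr (_ / (_ * _) *: _).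
by rewrite /pairs_of big_map big_enum.
Qed.

Lemma size_dynkin_letters d m q : q \in dynkin_pairs d m -> size (letters q) = d.
Proof. by rewrite mem_filter size_letters => /andP[/andP[_ /eqP ->]]. Qed.

End Words.

Section LowDegreeTerms.
Variables (R : realType) (n : nat) (mu : bracket R n).
Hypothesis mu_V : skew_bilinear mu.

Lemma bch_term0 x y : bch_term mu x y 0 = 0.
Proof. by rewrite /bch_term big_geq. Qed.

Local Ltac expand_pairs d m :=
  let l := eval vm_compute in (dynkin_pairs d m) in
  rewrite (_ : dynkin_pairs d m = l); [|by vm_compute].

Let fact1 : 1`! = 1%N. Proof. by []. Qed.
Let fact2 : 2`! = 2%N. Proof. by []. Qed.
Let fact3 : 3`! = 6%N. Proof. by []. Qed.

Lemma bch_term1 x y : bch_term mu x y 1 = x + y.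
Proof.
rewrite bch_termE big_nat1; expand_pairs 1%N 1%N.
rewrite !big_cons !big_nil /dynkin_coef !big_cons !big_nil /=.
rewrite fact0 fact1 !mul1r invr1 !scale1r addr0 addrC //.
Qed.

Lemma bch_term2 x y : bch_term mu x y 2 = 2^-1 *: mu x y.
Proof.
rewrite bch_termE big_ltn // big_nat1; expand_pairs 2%N 1%N; expand_pairs 2%N 2%N.
rewrite !big_cons !big_nil /dynkin_coef !big_cons !big_nil /=.
rewrite fact0 fact1 fact2 (br_skew mu_V y x) !(brxx mu_V).
by apply/colP => k; rewrite !mxE; field.
Qed.

(** Words whose last two letters agree vanish, and skew-symmetry merges those that differ by
    exchanging their last two letters; the rest is arithmetic of Dynkin's coefficients. *)
Lemma bch_term3 x y :
  bch_term mu x y 3 = 12^-1 *: (mu x (mu x y) + mu y (mu y x)).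
Proof.
rewrite bch_termE big_ltn // big_ltn // big_nat1.
expand_pairs 3%N 1%N; expand_pairs 3%N 2%N; expand_pairs 3%N 3%N.
rewrite !big_cons !big_nil /dynkin_coef !big_cons !big_nil /=.
rewrite fact0 fact1 fact2 fact3 (br_skew mu_V y x) !(brxx mu_V).
rewrite !(brNr mu_V) !(br0r mu_V).
by apply/colP => k; rewrite !mxE; field.
Qed.

End LowDegreeTerms.

(** * Finiteness of the series and inverses in the group *)

Section Truncation.
Variables (R : realType) (n : nat) (mu : bracket R n).
Hypothesis mu_V : skew_bilinear mu.

Lemma nested_lcs w : w != [::] ->
  lower_central mu (size w).-1 (nested_bracket mu w).
Proof.
elim: w => // x [|y w] IH _; first exact: LcsTop.
by apply: LcsBracket; exact: IH.
Qed.

(** A word of k + 1 letters lies in the k-th term of the lower central series, which starts at 0,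
    and every longer word has such a word as a suffix. *)
Lemma nested_eq0 k w : (forall x, lower_central mu k x -> x = 0) ->
  (k < size w)%N -> nested_bracket mu w = 0.
Proof.
move=> H; elim: w => // x w IH; rewrite ltnS leq_eqVlt => /orP[/eqP E|kw].
  by apply: H; rewrite E; apply: (@nested_lcs (x :: w)).
case: w kw IH => // y w kw IH.
by change (mu x (nested_bracket mu (y :: w)) = 0); rewrite IH // br0r.
Qed.

Lemma bch_term_eq0 k : (forall x, lower_central mu k x -> x = 0) ->
  forall x y d, (k < d)%N -> bch_term mu x y d = 0.
Proof.
move=> H x y d kd; rewrite bch_termE big1 // => m _.
rewrite big_seq big1 // => q /size_dynkin_letters sq.
by rewrite (@nested_eq0 k) ?scaler0 // size_map sq.
Qed.

Lemma bch_sum N x y : (forall d, (N <= d)%N -> bch_term mu x y d = 0) ->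
  bch mu x y = \sum_(0 <= d < N) bch_term mu x y d.
Proof.
move=> H; apply: lim_near_cst; first exact: norm_hausdorff.
exists N => //= M NM.
rewrite (big_cat_nat (leq0n N) NM) /= [X in _ + X]big_nat_cond [X in _ + X]big1 ?addr0//.
by move=> d; rewrite andbT => /andP[/H].
Qed.

(** The innermost bracket is taken between two multiples of [x]. *)
Lemma nested_opp_self c x : (1 < size c)%N ->
  nested_bracket mu (word c (- x) x) = 0.
Proof.
elim: c => // a [//|b [|d c]] IH _.
  by move: IH => _ /=; case: a; case: b; rewrite ?(brNr mu_V) ?(brNl mu_V) (brxx mu_V) ?oppr0.
change (mu (if a then - x else x) (nested_bracket mu (word [:: b, d & c] (- x) x)) = 0).
by rewrite IH // br0r.
Qed.

Lemma bch_opp_self x : bch mu (- x) x = 0.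
Proof.
have H d : (2 <= d)%N -> bch_term mu (- x) x d = 0.
  move=> d2; rewrite bch_termE big1 // => m _; rewrite big_seq big1 // => q.
  by move=> /size_dynkin_letters sq; rewrite nested_opp_self ?scaler0 // sq.
rewrite (bch_sum H) big_ltn // big_ltn // big_geq //.
by rewrite bch_term0 bch_term1 // addNr !addr0.
Qed.

End Truncation.

(** * Change of basis and naturality of the group law *)

Section Naturality.
Variables (R : realType) (n : nat) (mu : bracket R n) (h : 'M[R]_n).

(** For invertible [h], the bracket that makes [h] an isomorphism from [mu]. *)
Definition act : bracket R n := fun x y => h *m mu (invmx h *m x) (invmx h *m y).

Hypothesis h_unit : h \in unitmx.

Lemma actE x y : act (h *m x) (h *m y) = h *m mu x y.
Proof. by rewrite /act !mulKmx. Qed.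

Lemma nested_act w :
  nested_bracket act [seq h *m x | x <- w] = h *m nested_bracket mu w.
Proof.
elim: w => [|x [|y w] IH] //=; first by rewrite mulmx0.
by rewrite /= in IH; rewrite IH actE.
Qed.

Lemma bch_term_act x y d :
  bch_term act (h *m x) (h *m y) d = h *m bch_term mu x y d.
Proof.
rewrite !bch_termE mulmx_sumr; apply: eq_bigr => m _; rewrite mulmx_sumr.
apply: eq_bigr => q _; rewrite -scalemxAr -nested_act; congr (_ *: nested_bracket _ _).
by rewrite /word -map_comp; apply: eq_map => b /=; case: b.
Qed.

Hypothesis mu_V : skew_bilinear mu.

Lemma act_skew : skew_bilinear act.
Proof.
split.
- by move=> x a u v; rewrite /act mulmxDr -scalemxAr (brDr mu_V) (brZr mu_V) mulmxDr -scalemxAr.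
- by move=> x a u v; rewrite /act mulmxDr -scalemxAr (brDl mu_V) (brZl mu_V) mulmxDr -scalemxAr.
- by move=> x y; rewrite /act (br_skew mu_V) mulmxN.
Qed.

Lemma lcs_act k x : lower_central act k x -> lower_central mu k (invmx h *m x).
Proof.
elim=> {k x}.
- by move=> x; exact: LcsTop.
- by move=> k x y _ IH; rewrite /act mulKmx //; exact: LcsBracket.
- by move=> k x y _ IHx _ IHy; rewrite mulmxDr; exact: LcsAdd.
- by move=> k a x _ IH; rewrite -scalemxAr; exact: LcsScale.
Qed.

Lemma act_nilpotent_lie : nilpotent_lie mu -> nilpotent_lie act.
Proof.
move=> [_ Jac [k nil]]; split; first exact: act_skew.
  by move=> x y z; rewrite /act !mulKmx // -!mulmxDr Jac mulmx0.
exists k => x /lcs_act/nil E.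
by rewrite -[x](mulKVmx h_unit) E mulmx0.
Qed.

Lemma bch_act : nilpotent_bracket mu ->
  forall x y, bch act (h *m x) (h *m y) = h *m bch mu x y.
Proof.
move=> [k nil] x y.
have H d : (k.+1 <= d)%N -> bch_term mu x y d = 0 by exact: bch_term_eq0.
rewrite (bch_sum H) (@bch_sum _ _ _ k.+1); last first.
  by move=> d kd; rewrite bch_term_act H // mulmx0.
by rewrite mulmx_sumr; apply: eq_bigr => d _; rewrite bch_term_act.
Qed.

End Naturality.

(** * The differential of left translation by the inverse *)

Section Translations.
Variables (R : realType) (n : nat) (mu : bracket R n).
Hypothesis mu_V : skew_bilinear mu.

Lemma vanm_nested c (f g : 'cV[R]_n -> 'cV[R]_n) k : vanm k f -> vanm k g ->
  vanm (size c * k) (fun x => nested_bracket mu (word c (f x) (g x))).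
Proof.
move=> fk gk.
have fgk b : vanm k (fun x => if b then f x else g x) by case: b.
elim: c => [|b [|b' c] IH].
- move=> i j; apply: (@van_ext _ _ _ (fun=> 0)); last exact: van0.
  by move=> x; rewrite mxE.
- by rewrite mul1n; exact: fgk.
- by rewrite [size _]/= mulSn; exact (vanm_br mu_V (fgk b) IH).
Qed.

(* The derivative at y = x, in the direction v, of nested_bracket on
   word c (- x) y. *)
Fixpoint dnested (c : seq bool) (x v : 'cV[R]_n) : 'cV[R]_n :=
  match c with
  | [::] => 0
  | [:: b] => if b then 0 else v
  | b :: c' => mu (if b then 0 else v) (nested_bracket mu (word c' (- x) x))
               + mu (if b then - x else x) (dnested c' x v)
  end.

Lemma dwithinmx_line (x v : 'cV[R]_n) : dwithinmx setT (fun s => s *: v + x) 0 v.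
Proof. by move=> i j; rewrite (ord1 j); exact: dwithin_coord. Qed.

Arguments dwithinmx_line x v : clear implicits.

Lemma dwithinmx_nested c x v :
  dwithinmx setT (fun s => nested_bracket mu (word c (- x) (s *: v + x))) 0
    (dnested c x v).
Proof.
have H b : dwithinmx setT (fun s => if b then - x else s *: v + x) 0
    (if b then 0 else v).
  by case: b; [exact: dwithinmx_cst|exact: dwithinmx_line].
elim: c => [|b [|b' c] IH]; [exact: dwithinmx_cst|exact: H|].
have := dwithinmx_br mu_V (H b) IH.
by rewrite scale0r add0r.
Qed.

(** Differentiation replaces one letter by the constant [v], which costs one order. *)
Lemma vanm_dnested c v : vanm (size c).-1 (fun x => dnested c x v).
Proof.
have cst (w : 'cV[R]_n) : vanm 0 (fun _ : 'cV[R]_n => w) by exact: vanm_cst.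
have idm : vanm 1 (fun x : 'cV[R]_n => x) by exact: vanm_id.
elim: c => [|b [|b' c] IH]; [exact: cst|exact: cst|].
apply: vanmD.
  have := vanm_br mu_V (cst (if b then 0 else v))
    (vanm_nested (b' :: c) (vanmN idm) idm).
  by rewrite muln1 add0n.
have bx : vanm 1 (fun x : 'cV[R]_n => if b then - x else x).
  by case: b; [exact: vanmN|].
exact: (vanm_br mu_V bx IH).
Qed.

(** The contribution of degree [d] of the series to the differential at [x], in the direction [v],
    of left translation by [- x]. *)
Definition dterm (x v : 'cV[R]_n) (d : nat) : 'cV[R]_n :=
  \sum_(1 <= m < d.+1) \sum_(q <- dynkin_pairs d m)
    dynkin_coef R d m q *: dnested (letters q) x v.

Lemma dwithinmx_bch_term d x v :
  dwithinmx setT (fun s => bch_term mu (- x) (s *: v + x) d) 0 (dterm x v d).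
Proof.
apply: dwithinmx_ext (fun s => esym (bch_termE _ _ _ _)) _.
apply: dwithinmx_sum => m _; apply: dwithinmx_sum => q _; apply: dwithinmx_scale.
exact: dwithinmx_nested.
Qed.

Arguments dwithinmx_bch_term d x v : clear implicits.

Lemma vanm_dterm d v : vanm d.-1 (fun x => dterm x v d).
Proof.
apply: vanm_sum => m _.
have H : vanm d.-1 (fun x => \sum_(q <- dynkin_pairs d m | q \in dynkin_pairs d m)
    dynkin_coef R d m q *: dnested (letters q) x v).
  apply: vanm_sum => q /size_dynkin_letters <-; apply: vanmZ.
  exact: vanm_dnested.
by apply: vanm_ext H => x; rewrite -big_seq.
Qed.

(** Lets [dterm] be evaluated in degrees 1, 2 and 3 by differentiating the closed forms of
    [bch_term], without expanding [dnested] word by word. *)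
Lemma dwithinmx_uniq p q (A : R -> 'M[R]_(p, q)) t L M :
  dwithinmx setT A t L -> dwithinmx setT A t M -> L = M.
Proof.
move=> AL AM; apply/matrixP => i j.
have F : ProperFilter (within setT t^').
  rewrite (_ : within setT t^' = t^'); first exact: Proper_dnbhs_numFieldType.
  rewrite eqEsubset; split => A' /=; rewrite /within /= => h.
    by apply: filterS h => s; apply.
  by apply: filterS h => s As _.
exact: (cvg_unique (@Rhausdorff R) (AL i j) (AM i j)).
Qed.

Lemma dterm0 x v : dterm x v 0 = 0.
Proof. by rewrite /dterm big_geq. Qed.

Lemma dterm1 x v : dterm x v 1 = v.
Proof.
apply: dwithinmx_uniq (dwithinmx_bch_term 1 x v) _.
apply: dwithinmx_ext (fun s => esym (bch_term1 mu (- x) (s *: v + x))) _.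
by have := dwithinmx_add (dwithinmx_cst setT (- x) 0) (dwithinmx_line x v); rewrite add0r.
Qed.

Lemma dterm2 x v : dterm x v 2 = - 2^-1 *: mu x v.
Proof.
apply: dwithinmx_uniq (dwithinmx_bch_term 2 x v) _.
apply: dwithinmx_ext (fun s => esym (bch_term2 mu_V (- x) (s *: v + x))) _.
have := dwithinmx_scale 2^-1 (dwithinmx_br mu_V (dwithinmx_cst setT (- x) 0) (dwithinmx_line x v)).
by rewrite (br0l mu_V) add0r (brNl mu_V) scalerN scaleNr.
Qed.

(** Each of the two cubic brackets contributes [mu x (mu x v)], since [- x] and [x] commute; hence
    2/12. *)
Lemma dterm3 x v : dterm x v 3 = 6^-1 *: mu x (mu x v).
Proof.
apply: dwithinmx_uniq (dwithinmx_bch_term 3 x v) _.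
apply: dwithinmx_ext (fun s => esym (bch_term3 mu_V (- x) (s *: v + x))) _.
have C := dwithinmx_cst setT (- x) 0; have L := dwithinmx_line x v.
have := dwithinmx_scale 12^-1 (dwithinmx_add (dwithinmx_br mu_V C (dwithinmx_br mu_V C L))
  (dwithinmx_br mu_V L (dwithinmx_br mu_V L C))).
rewrite scale0r add0r (br_skew mu_V v (- x)).
rewrite !(br0l mu_V, br0r mu_V, brNr mu_V, brNl mu_V, brxx mu_V, add0r, addr0,
  oppr0, opprK).
suff -> : 12^-1 *: (mu x (mu x v) + mu x (mu x v)) = 6^-1 *: mu x (mu x v) by [].
by apply/colP => k; rewrite !mxE; field.
Qed.

Hypothesis mu_nil : nilpotent_bracket mu.

Lemma bch_polynomial z : vanm 0 (fun y => bch mu z y).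
Proof.
have [k nil] := mu_nil.
apply: (@vanm_ext _ _ _ _ _ (fun y => \sum_(0 <= d < k.+1) bch_term mu z y d)).
  by move=> y; rewrite -bch_sum // => d; exact: bch_term_eq0.
apply: vanm_sum => d _.
apply: vanm_ext (fun y => esym (bch_termE _ _ _ _)) _.
apply: vanm_sum => m _; apply: vanm_sum => q _; apply: vanmZ.
have idm : vanm 0 (fun y : 'cV[R]_n => y) by apply: vanm_le (@vanm_id _ _).
have := vanm_nested (letters q) (vanm_cst n z) idm.
by rewrite muln0.
Qed.

(** These are the first terms of (1 - e^(-ad x)) / ad x, the left Maurer-Cartan form in exponential
    coordinates. *)
Lemma bch_jacobian_jet : exists2 r : 'cV[R]_n -> 'M[R]_n, vanm 3 r &
  forall x, jacobian_mx (bch mu (- x)) x =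
    1%:M - 2^-1 *: ad_mx mu x + 6^-1 *: (ad_mx mu x *m ad_mx mu x) + r x.
Proof.
(* The bound [N] exceeds [k], so that the series stops before it, and is at least 4, so that degrees
   0 to 3 can be split off. The remainder collects the degrees d >= 4, whose derivatives have order
   d - 1 >= 3. *)
have [k nil] := mu_nil; pose N := (k + 4)%N.
exists (fun x => \matrix_(i, j) (\sum_(4 <= d < N) dterm x (stdv R j) d) i 0).
  move=> i j.
  have H : vanm 3 (fun x => \sum_(4 <= d < N | (4 <= d)%N) dterm x (stdv R j) d).
    by apply: vanm_sum => d d4; apply: vanm_le (vanm_dterm d _); case: d d4.
  apply: van_ext (H i 0) => x; rewrite mxE; congr (fun_of_matrix _ i 0).
  rewrite [LHS]big_nat_cond [RHS]big_nat; apply: eq_bigl => d.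
  by case: (leqP 4 d); rewrite ?andbF ?andbT.
move=> x; apply/matrixP => i j; rewrite mxE /partial.
have H : dwithinmx setT (fun s => bch mu (- x) (s *: stdv R j + x)) 0
    (\sum_(0 <= d < N) dterm x (stdv R j) d).
  apply: (@dwithinmx_ext _ _ _ _
    (fun s => \sum_(0 <= d < N) bch_term mu (- x) (s *: stdv R j + x) d)).
    move=> s; rewrite -bch_sum // => d Nd; apply: bch_term_eq0 nil _ _ _ _ => //.
    by apply: leq_trans Nd; rewrite /N addnS ltnS leq_addr.
  by apply: dwithinmx_sum => d _; exact: dwithinmx_bch_term.
rewrite (dwithin_derive (f := fun y => bch mu (- x) y i 0) (H i 0)).
have N4 : (4 <= N)%N by rewrite leq_addl.
rewrite (big_cat_nat (leq0n 4) N4) /= mxE [in RHS]mxE.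
congr (_ + _); last by rewrite mxE.
rewrite big_ltn // big_ltn // big_ltn // big_ltn // big_geq // dterm0 dterm1 dterm2 dterm3 !(br_ad mu_V) mulmxA.
have cE (M : 'M[R]_n) : (M *m stdv R j) i 0 = M i j by rewrite -colE mxE.
by rewrite -[RHS]cE !mulmxDl mul1mx mulNmx -!scalemxAl add0r addr0 addrA scaleNr.
Qed.

End Translations.

(** * The Ricci tensor at the origin *)

Section RicciAlgebra.
Variables (R : realType) (n : nat) (G P : 'M[R]_n) (A : 'I_n -> 'M[R]_n).
Hypothesis G_sym : G^T = G.
Hypothesis PG : P *m G = 1%:M.
Hypothesis A_skew : forall i j k, A i k j = - A j k i.
Hypothesis trA : forall i, \tr (A i) = 0.
Hypothesis trAA : forall i j, \tr (A i *m A j) = 0.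

(* The first and second derivatives at 0 of J^T G J, where
   J = 1 - ad / 2 + ad^2 / 6 and A i = ad e_i; jet_gamma and jet_dgamma are the
   Christoffel symbols of such a metric and their derivatives. *)
Definition jet1 l : 'M[R]_n := - 2^-1 *: ((A l)^T *m G + G *m A l).

Definition jet2 m l : 'M[R]_n :=
  4^-1 *: ((A l)^T *m G *m A m + (A m)^T *m G *m A l)
  + 6^-1 *: ((A l *m A m + A m *m A l)^T *m G + G *m (A l *m A m + A m *m A l)).

Definition jet_gamma l j k : R :=
  2^-1 * \sum_m P l m * (jet1 j k m + jet1 k j m - jet1 m j k).

Definition jet_dgamma a l j k : R :=
  2^-1 * \sum_m ((- (P *m jet1 a *m P)) l m * (jet1 j k m + jet1 k j m - jet1 m j k)
    + P l m * (jet2 a j k m + jet2 a k j m - jet2 a m j k)).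

(* K_k (m, j) = <[e_j, e_m], e_k> *)
Definition Kmx k : 'M[R]_n := \matrix_(m, j) (G *m A j) k m.

Let GP : G *m P = 1%:M. Proof. exact: mulmx1C. Qed.

Let P_sym : P^T = P.
Proof.
have H : P^T *m G = 1%:M by rewrite -[in LHS]G_sym -trmx_mul GP trmx1.
by rewrite -[P^T]mulmx1 -GP mulmxA H mul1mx.
Qed.

Let P_symE i j : P i j = P j i. Proof. by rewrite -[in LHS]P_sym mxE. Qed.

Let GA_skew i j k : (G *m A i) k j = - (G *m A j) k i.
Proof.
by rewrite !mxE -sumrN; apply: eq_bigr => l _; rewrite A_skew mulrN.
Qed.

Let MA_skew (M : 'M[R]_n) i j k : (M *m A i) k j = - (M *m A j) k i.
Proof.
by rewrite !mxE -sumrN; apply: eq_bigr => l _; rewrite A_skew mulrN.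
Qed.

Let AG i j k : ((A i)^T *m G) j k = (G *m A i) k j.
Proof. by rewrite -[in LHS]G_sym -trmx_mul mxE. Qed.

Let K_skew k : (Kmx k)^T = - Kmx k.
Proof.
apply/matrixP => i j; rewrite [LHS]mxE [LHS]mxE GA_skew [RHS]mxE.
by congr (- _); rewrite [RHS]mxE.
Qed.

Lemma sum_trace (M N : 'M[R]_n) : \sum_i \sum_l M i l * N l i = \tr (M *m N).
Proof. by apply: eq_bigr => i _; rewrite mxE. Qed.

Lemma sum_symm (f : 'I_n -> 'I_n -> R) :
  \sum_i \sum_l P i l * f i l = \sum_i \sum_l P i l * f l i.
Proof.
rewrite exchange_big; apply: eq_bigr => i _; apply: eq_bigr => l _.
by rewrite P_symE.
Qed.

Lemma sum_skew (f : 'I_n -> 'I_n -> R) : (forall i l, f i l = - f l i) ->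
  \sum_i \sum_l P i l * f i l = 0.
Proof.
move=> H; have E : \sum_i \sum_l P i l * f i l = - \sum_i \sum_l P i l * f i l.
  rewrite [LHS]sum_symm -sumrN; apply: eq_bigr => i _; rewrite -sumrN.
  by apply: eq_bigr => l _; rewrite H mulrN.
by apply/eqP; rewrite -[_ == 0](mulrn_eq0 _ 2) mulr2n {1}E addNr.
Qed.

(** [S] pairs [A j] with [A k] through the metric transpose. The mixed contraction [Z] occurs,
    symmetrized and with coefficient 1/4, both in the divergence of the Christoffel symbols and in
    their quadratic term, and cancels in [jet_ricci]. *)
Let S j k := \tr (P *m (A j)^T *m G *m A k).
Let Z j k := \tr (Kmx k *m P *m (A j)^T).

Let S_sym j k : S j k = S k j.
Proof.
rewrite /S -[LHS]mxtrace_tr !trmx_mul trmxK G_sym P_sym.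
by rewrite !mulmxA mxtrace_mulC !mulmxA.
Qed.

Lemma jet1E l i j : jet1 l i j = - 2^-1 * ((G *m A l) j i + (G *m A l) i j).
Proof. by rewrite /jet1 mxE [X in _ * X]mxE AG. Qed.

(** Koszul's formula in the coordinate frame. Christoffel symbols are symmetric in j and k, so the
    term <[e_j, e_k], e_m> of a left-invariant frame does not occur. *)
Lemma jet_lowerE j k m : jet1 j k m + jet1 k j m - jet1 m j k =
  - (Kmx j m k + (G *m A j) k m).
Proof.
rewrite !jet1E [Kmx j m k]mxE (GA_skew k j m) (GA_skew m j k) (GA_skew m k j).
by field.
Qed.

Lemma jet1_sym l i j : jet1 l i j = jet1 l j i.
Proof. by rewrite !jet1E addrC. Qed.

Lemma jet_gamma_sym l j k : jet_gamma l j k = jet_gamma l k j.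
Proof.
by congr (_ * _); apply: eq_bigr => m _; rewrite (jet1_sym m j k) (addrC (jet1 j k m)).
Qed.

Let Gam j : 'M[R]_n := - 2^-1 *: (P *m (Kmx j + (A j)^T *m G)).

Lemma jet_gammaE l j k : jet_gamma l j k = Gam j l k.
Proof.
rewrite /jet_gamma /Gam mxE mxE mulNr -mulrN; congr (_ * _); rewrite -sumrN.
by apply: eq_bigr => m _; rewrite jet_lowerE mulrN [in RHS]mxE AG.
Qed.

Lemma eq_opp_eq0 (x : R) : x = - x -> x = 0.
Proof. by move=> H; lra. Qed.

Let trPK k : \tr (P *m Kmx k) = 0.
Proof.
apply: eq_opp_eq0; rewrite -[LHS]mxtrace_tr trmx_mul K_skew P_sym mulNmx.
by rewrite raddfN /= mxtrace_mulC.
Qed.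

Let trPATG M : \tr (P *m M^T *m G) = \tr M.
Proof. by rewrite -mulmxA mxtrace_mulC -mulmxA GP mulmx1 mxtrace_tr. Qed.

Let trPGA M : \tr (P *m (G *m M)) = \tr M.
Proof. by rewrite mulmxA PG mul1mx. Qed.

(** The sum is the derivative of log sqrt (det g) at the origin. Its part in [Kmx] is the trace of a
    symmetric times a skew matrix, and the rest is tr ad = 0. *)
Lemma sum_jet_gamma m : \sum_i jet_gamma i i m = 0.
Proof.
transitivity (\tr (Gam m)).
  by apply: eq_bigr => i _; rewrite jet_gamma_sym jet_gammaE.
by rewrite /Gam mxtraceZ mulmxDr raddfD /= trPK mulmxA trPATG trA addr0 mulr0.
Qed.

Lemma sum_jet_gamma2 j k : \sum_i \sum_m jet_gamma m i k * jet_gamma i j m =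
  4^-1 * (Z j k + Z k j + \tr (P *m Kmx k *m P *m Kmx j)).
Proof.
transitivity (\tr (Gam k *m Gam j)).
  rewrite -sum_trace exchange_big; apply: eq_bigr => m _; apply: eq_bigr => i _.
  by rewrite jet_gamma_sym !jet_gammaE.
rewrite /Gam -scalemxAl -scalemxAr !mxtraceZ mulrA.
rewrite !mulmxDr !mulmxDl !raddfD /=.
have -> : \tr (P *m ((A k)^T *m G) *m (P *m ((A j)^T *m G))) = 0.
  rewrite !mulmxA -[P *m (A k)^T *m G *m P]mulmxA GP mulmx1.
  by rewrite -[P *m _ *m _]mulmxA -trmx_mul trPATG trAA.
have -> : \tr (P *m ((A k)^T *m G) *m (P *m Kmx j)) = Z k j.
  rewrite !mulmxA -[P *m (A k)^T *m G *m P]mulmxA GP mulmx1 /Z.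
  by rewrite -[Kmx j *m P *m _]mulmxA [RHS]mxtrace_mulC.
have -> : \tr (P *m Kmx k *m (P *m ((A j)^T *m G))) = Z j k.
  rewrite -!mulmxA mxtrace_mulC -!mulmxA GP mulmx1 /Z !mulmxA //.
by rewrite !mulmxA; field.
Qed.

(** The two kinds of quadratic terms in [jet2]: [s l m i j] is <[e_l, e_i], [e_m, e_j]> and
    [u l m i j] is <e_i, [e_l, [e_m, e_j]]>. Skew-symmetry of the inner brackets exchanges a
    direction with a matrix index. *)
Let s l m i j := ((A l)^T *m G *m A m) i j.
Let u l m i j := (G *m A l *m A m) i j.

Let s_tr l m i j : s l m i j = s m l j i.
Proof.
have E : (A m)^T *m G *m A l = ((A l)^T *m G *m A m)^T.
  by rewrite !trmx_mul trmxK G_sym mulmxA.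
by rewrite /s E [RHS]mxE.
Qed.

Let s_skewr l m i j : s l m i j = - s l j i m. Proof. exact: MA_skew. Qed.

Let s_skewl l m i j : s l m i j = - s i m l j.
Proof. by rewrite s_tr s_skewr s_tr. Qed.

Let u_skew l m i j : u l m i j = - u l j i m. Proof. exact: MA_skew. Qed.

Lemma jet2E m l i j : jet2 m l i j = 4^-1 * (s l m i j + s m l i j) +
  6^-1 * (u l m j i + u m l j i + (u l m i j + u m l i j)).
Proof.
rewrite /jet2 [LHS]mxE; congr (_ + _).
  by rewrite [LHS]mxE [X in _ * X = _]mxE.
rewrite [LHS]mxE [X in _ * X = _]mxE; congr (_ * (_ + _)); last first.
  by rewrite mulmxDr !mulmxA [LHS]mxE.
by rewrite -[G in LHS]G_sym -trmx_mul [LHS]mxE mulmxDr !mulmxA [LHS]mxE.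
Qed.

Lemma jet2_sym m l i j : jet2 m l i j = jet2 m l j i.
Proof.
rewrite !jet2E (s_tr l m i j) (s_tr m l i j) [s m l j i + _]addrC.
by rewrite [u l m j i + _ + _]addrC.
Qed.

(** This and the next contractions with the inverse metric reduce to four cases: a skew expression
    against the symmetric [P], a trace tr ad or tr (ad ad) that vanishes, or one of [S] and [Z]. *)
Let sum_s1 j k : \sum_i \sum_l P i l * s j i k l = 0.
Proof. by apply: sum_skew => i l; exact: s_skewr. Qed.

Let sum_s2 j k : \sum_i \sum_l P i l * s i j k l = - S k j.
Proof.
rewrite sum_symm; under eq_bigr do under eq_bigr do rewrite s_skewl mulrN.
under eq_bigr do rewrite sumrN.
by rewrite sumrN (sum_trace P ((A k)^T *m G *m A j)) /S !mulmxA.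
Qed.

Let sum_u1 j k : \sum_i \sum_l P i l * u j i l k = 0.
Proof.
under eq_bigr do under eq_bigr do rewrite u_skew mulrN.
under eq_bigr do rewrite sumrN.
by rewrite sumrN (sum_trace P (G *m A j *m A k)) !mulmxA PG mul1mx trAA oppr0.
Qed.

Let sum_u2 j k : \sum_i \sum_l P i l * u i j l k = 0.
Proof.
transitivity (\sum_i (A i *m A j) i k).
  apply: eq_bigr => i _; rewrite -[A i in RHS]mul1mx -PG -!mulmxA [RHS]mxE.
  by apply: eq_bigr => l _; rewrite /u -mulmxA.
under eq_bigr do rewrite mxE.
rewrite exchange_big big1 // => m _.
(* The entry (i, m) of [A i] is minus the diagonal entry (i, i) of [A m], so the sum over i is a
   trace. *)
under eq_bigr do rewrite A_skew mulNr.
by rewrite sumrN -mulr_suml -/(mxtrace (A m)) trA mul0r oppr0.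
Qed.

Let sum_u3 j k : \sum_i \sum_l P i l * u j i k l = 0.
Proof. by apply: sum_skew => i l; exact: u_skew. Qed.

Let sum_u4 j k : \sum_i \sum_l P i l * u i j k l = Z j k.
Proof.
rewrite /Z -mulmxA -sum_trace [RHS]exchange_big; apply: eq_bigr => i _ /=.
under [RHS]eq_bigr do rewrite [in X in _ * X]mxE mulr_sumr.
rewrite [RHS]exchange_big /=; apply: eq_bigr => l _.
rewrite /u mxE mulr_sumr; apply: eq_bigr => m _.
rewrite [Kmx _ _ _]mxE [(A j)^T _ _]mxE; ring.
Qed.

Let sum_s3 j k : \sum_i \sum_l P i l * s l i j k = S j k.
Proof.
under eq_bigr do under eq_bigr do rewrite s_skewl s_skewr opprK.
by rewrite (sum_trace P ((A j)^T *m G *m A k)) /S !mulmxA.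
Qed.

Let sum_u5 j k : \sum_i \sum_l P i l * u l i k j = - Z j k.
Proof.
rewrite -sum_u4 [in RHS]sum_symm -sumrN; apply: eq_bigr => i _.
by rewrite -sumrN; apply: eq_bigr => l _; rewrite u_skew mulrN.
Qed.

Let sum_jet2a j k : \sum_i \sum_l P i l * jet2 i j k l =
  - 4^-1 * S k j + 6^-1 * Z j k.
Proof.
transitivity (4^-1 * (\sum_i \sum_l P i l * s j i k l + \sum_i \sum_l P i l * s i j k l)
  + 6^-1 * (\sum_i \sum_l P i l * u j i l k + \sum_i \sum_l P i l * u i j l k
   + (\sum_i \sum_l P i l * u j i k l + \sum_i \sum_l P i l * u i j k l))).
  rewrite -!big_split !mulr_sumr -big_split; apply: eq_bigr => i _.
  rewrite -!big_split !mulr_sumr -big_split; apply: eq_bigr => l _.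
  by rewrite jet2E /=; ring.
by rewrite sum_s1 sum_s2 sum_u1 sum_u2 sum_u3 sum_u4; ring.
Qed.

Let sum_jet2b j k : \sum_i \sum_l P i l * jet2 i l j k =
  2^-1 * S j k - 3^-1 * (Z j k + Z k j).
Proof.
transitivity (4^-1 * (\sum_i \sum_l P i l * s l i j k + \sum_i \sum_l P i l * s i l j k)
  + 6^-1 * (\sum_i \sum_l P i l * u l i k j + \sum_i \sum_l P i l * u i l k j
   + (\sum_i \sum_l P i l * u l i j k + \sum_i \sum_l P i l * u i l j k))).
  rewrite -!big_split !mulr_sumr -big_split; apply: eq_bigr => i _.
  rewrite -!big_split !mulr_sumr -big_split; apply: eq_bigr => l _.
  by rewrite jet2E /=; ring.
rewrite [X in _ * (_ + X)]sum_symm [X in _ * (_ + X + _)]sum_symm.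
rewrite [X in _ * (_ + (_ + X))]sum_symm !sum_s3 !sum_u5 ; by field.
Qed.

(** The divergence of the inverse metric vanishes at the origin, so in [sum_jet_dgamma_div] only the
    second derivatives of the metric contribute. *)
Let sum_jet1 (w : 'I_n -> R) :
  \sum_i \sum_m (- (P *m jet1 i *m P)) i m * w m = 0.
Proof.
have row0 b : \sum_i (P *m jet1 i) i b = 0.
  transitivity (- 2^-1 * (\sum_i \sum_a P i a * (G *m A i) b a +
                         \sum_i \sum_a P i a * (G *m A i) a b)).
    rewrite -big_split mulr_sumr; apply: eq_bigr => i _.
    rewrite -big_split mulr_sumr mxE; apply: eq_bigr => a _.
    by rewrite jet1E /=; ring.
  rewrite sum_skew // add0r.
  under eq_bigr do under eq_bigr do rewrite GA_skew mulrN.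
  under eq_bigr do rewrite sumrN.
  by rewrite sumrN sum_trace trPGA trA oppr0 mulr0.
rewrite exchange_big big1 // => m _; rewrite -mulr_suml.
under eq_bigr do rewrite mxE [X in - X]mxE.
rewrite sumrN exchange_big big1 ?oppr0 ?mul0r // => b _.
by rewrite -mulr_suml row0 mul0r.
Qed.

Lemma sum_jet_dgamma_div j k : \sum_i jet_dgamma i i j k =
  - 2^-1 * S j k + 4^-1 * (Z j k + Z k j).
Proof.
transitivity (2^-1 * (\sum_i \sum_m (- (P *m jet1 i *m P)) i m *
      (jet1 j k m + jet1 k j m - jet1 m j k) +
    (\sum_i \sum_m P i m * jet2 i j k m + \sum_i \sum_m P i m * jet2 i k j m
     - \sum_i \sum_m P i m * jet2 i m j k))).
  rewrite -big_split -sumrB -big_split mulr_sumr; apply: eq_bigr => i _.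
  rewrite /jet_dgamma; congr (_ * _).
  by rewrite -big_split -sumrB -big_split; apply: eq_bigr => m _ /=; ring.
rewrite (sum_jet1 (fun m => jet1 j k m + jet1 k j m - jet1 m j k)).
rewrite (sum_jet2a j k) (sum_jet2a k j) (sum_jet2b j k) (S_sym k j).
by move: (S j k) (Z j k) (Z k j) => x y z; field.
Qed.

(** The Hessian of log sqrt (det g) at the origin: the left-invariant volume of a nilpotent group is
    constant in exponential coordinates. Here the second derivatives of the metric give [S j k] / 2,
    which the derivative of the inverse metric cancels. *)
Lemma sum_jet_dgamma_tr j k : \sum_i jet_dgamma j i i k = 0.
Proof.
transitivity (2^-1 * (\sum_i \sum_m (- (P *m jet1 j *m P)) i m *
      (- (Kmx k + (A k)^T *m G)) m i +
    (\sum_i \sum_m P i m * jet2 j i k m - \sum_i \sum_m P i m * jet2 j m i k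
     + \sum_i \sum_m P i m * jet2 j k m i))).
  rewrite -sumrB -!big_split mulr_sumr; apply: eq_bigr => i _.
  rewrite /jet_dgamma; congr (_ * _).
  rewrite -sumrB -!big_split; apply: eq_bigr => m _ /=.
  rewrite (jet2_sym j k i m) (addrC (jet1 i k m)) (jet1_sym m i k) jet_lowerE.
  rewrite [(- (Kmx k + _)) m i]mxE [(Kmx k + _) m i]mxE AG; ring.
rewrite [X in _ - X]sum_symm.
under [X in _ - X]eq_bigr do under eq_bigr do rewrite jet2_sym.
rewrite subrr add0r !sum_trace mulNmx mulmxN opprK.
have -> : \tr (P *m jet2 j k) = 2^-1 * S j k.
  rewrite /jet2 !mulmxDr -!scalemxAr raddfD /= !mxtraceZ !mulmxDr !raddfD /=.
  rewrite !mulmxA PG !mul1mx mulmxDr mulmxDl raddfD /= !trPATG !trAA.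
  rewrite -/(S k j) -/(S j k) S_sym.
  by move: (S j k) => x; field.
have -> : \tr (P *m jet1 j *m P *m (Kmx k + (A k)^T *m G)) = - 2^-1 * S j k.
  rewrite /jet1 -scalemxAr -!scalemxAl mxtraceZ; congr (_ * _).
  rewrite !mulmxDr !mulmxDl !raddfD /= !mulmxA.
  rewrite -[P *m (A j)^T *m G *m P]mulmxA GP mulmx1 PG mul1mx.
  have -> : \tr (P *m (A j)^T *m Kmx k) = - \tr (A j *m P *m Kmx k).
    rewrite -[LHS]mxtrace_tr !trmx_mul trmxK K_skew P_sym mulNmx raddfN /=.
    by rewrite mxtrace_mulC.
  rewrite -[P *m (A j)^T *m (A k)^T]mulmxA -trmx_mul trPATG trAA.
  have -> : \tr (A j *m P *m (A k)^T *m G) = S j k.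
    by rewrite -S_sym /S -!mulmxA [LHS]mxtrace_mulC !mulmxA.
  by rewrite addNr !add0r.
by move: (S j k) => x; field.
Qed.

Theorem jet_ricci j k :
  \sum_i (jet_dgamma i i j k - jet_dgamma j i i k +
    \sum_m (jet_gamma m j k * jet_gamma i i m - jet_gamma m i k * jet_gamma i j m)) =
  - 2^-1 * \tr (P *m (A j)^T *m G *m A k)
  - 4^-1 * \tr (P *m Kmx k *m P *m Kmx j).
Proof.
transitivity (\sum_i jet_dgamma i i j k - \sum_i jet_dgamma j i i k +
   (\sum_m jet_gamma m j k * \sum_i jet_gamma i i m -
    \sum_i \sum_m jet_gamma m i k * jet_gamma i j m)).
  under [X in _ = _ + (X - _)]eq_bigr do rewrite mulr_sumr.
  rewrite [X in _ = _ + (X - _)]exchange_big /= -!sumrB -big_split.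
  by apply: eq_bigr => i _; rewrite sumrB.
under [X in _ + (X - _)]eq_bigr do rewrite sum_jet_gamma mulr0.
rewrite sumr_const mul0rn sum_jet_gamma2 sum_jet_dgamma_div sum_jet_dgamma_tr.
by rewrite -/(S j k); ring.
Qed.
End RicciAlgebra.

(** * Traces of nilpotent matrices and of the adjoint representation *)

Section NilpotentTrace.
Variable R : fieldType.

Lemma iter_mulmx n p (M : 'M[R]_n) (N : 'M[R]_(n, p)) k :
  iter k (mulmx M) N = iter k (mulmx M) 1%:M *m N.
Proof. by elim: k => [|k IH] /=; rewrite ?mul1mx // IH mulmxA. Qed.

Lemma iter_mulmx_unit n (M : 'M[R]_n) k :
  M \in unitmx -> iter k (mulmx M) 1%:M \in unitmx.
Proof. by move=> U; elim: k => [|k IH] /=; rewrite ?unitmx1 // unitmx_mul U. Qed.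

Lemma iter_mulmx_swap n r (B : 'M[R]_(r, n)) (C : 'M[R]_(n, r)) k :
  iter k.+1 (mulmx (B *m C)) 1%:M = B *m iter k (mulmx (C *m B)) 1%:M *m C.
Proof.
elim: k => [|k IH]; first by rewrite /= !mulmx1.
by rewrite iterS IH /= !mulmxA.
Qed.

(* M = C B with C injective and B surjective through a space of dimension
   rank M < n, and tr (C B) = tr (B C) with B C again nilpotent. *)
Lemma mxtrace_nilpotent n (M : 'M[R]_n) k :
  iter k (mulmx M) 1%:M = 0 -> \tr M = 0.
Proof.
elim/ltn_ind: n M k => n IH M k Mk.
have [r_lt|n_le] := ltnP (\rank M) n.
  rewrite -(mulmx_base M) mxtrace_mulC; apply: (IH _ r_lt _ k.+1).
  by rewrite iter_mulmx_swap mulmx_base Mk mulmx0 mul0mx.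
have Mu : M \in unitmx.
  by rewrite -row_free_unit /row_free eqn_leq rank_leq_row n_le.
(* In full rank the vanishing power is invertible, which forces size 0. *)
have := iter_mulmx_unit k Mu; rewrite Mk => /mxrank_unit; rewrite mxrank0 => n0.
by case: n n0 {IH n_le Mu Mk} M => // _ M; rewrite /mxtrace big_ord0.
Qed.

End NilpotentTrace.

Section AdjointTrace.
Variables (R : realType) (n : nat) (mu : bracket R n).
Hypothesis mu_V : skew_bilinear mu.
Hypothesis mu_nil : nilpotent_bracket mu.

Lemma ad_nilpotent : exists k, forall x, iter k (mulmx (ad_mx mu x)) 1%:M = 0.
Proof.
have [k nil] := mu_nil; exists k => x.
have lc j v : lower_central mu j (iter j (mulmx (ad_mx mu x)) v).
  elim: j => [|j IH] /=; first exact: LcsTop.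
  by rewrite -(br_ad mu_V); exact: LcsBracket.
apply/matrixP => i j; rewrite mxE.
have := nil _ (lc k (stdv R j)); rewrite iter_mulmx -colE => /colP/(_ i).
by rewrite !mxE.
Qed.

Lemma tr_ad x : \tr (ad_mx mu x) = 0.
Proof. by have [k H] := ad_nilpotent; apply: mxtrace_nilpotent (H x). Qed.

Lemma tr_ad_sqr x : \tr (ad_mx mu x *m ad_mx mu x) = 0.
Proof.
have [k H] := ad_nilpotent; set M := ad_mx mu x.
apply: (@mxtrace_nilpotent _ _ _ k).
have E j : iter j (mulmx (M *m M)) 1%:M =
    iter j (mulmx M) 1%:M *m iter j (mulmx M) 1%:M.
  elim: j => [|j IH] /=; first by rewrite mulmx1.
  have C i : iter i (mulmx M) 1%:M *m M = M *m iter i (mulmx M) 1%:M.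
    by elim: i => [|i IHi] /=; rewrite ?mulmx1 ?mul1mx // -mulmxA IHi.
  by rewrite IH -!mulmxA; congr (_ *m _); rewrite !mulmxA C.
by rewrite E H mul0mx.
Qed.

(** Polarization of [tr_ad_sqr], which spares a common triangular form of all the [ad x]. *)
Lemma tr_ad_ad x y : \tr (ad_mx mu x *m ad_mx mu y) = 0.
Proof.
have := tr_ad_sqr (x + y).
rewrite (adD mu_V) mulmxDl !mulmxDr !raddfD /= !tr_ad_sqr add0r addr0.
by rewrite mxtrace_mulC => H; lra.
Qed.

End AdjointTrace.

Section InnerProducts.
Variables (R : realType) (n : nat).

Lemma inner_product_unit (Q : 'M[R]_n) : inner_product Q -> Q \in unitmx.
Proof.
move=> [_ Qpos]; rewrite -row_free_unit -kermx_eq0; apply/eqP/row_matrixP => i.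
rewrite row0; apply/eqP/negPn/negP => ri0.
have := Qpos (row i (kermx Q))^T; rewrite trmx_eq0 => /(_ ri0).
by rewrite trmxK -row_mul mulmx_ker row0 mul0mx mxE ltxx.
Qed.

End InnerProducts.

Lemma trmx_scale (R : comNzRingType) m n c (M : 'M[R]_(m, n)) :
  (c *: M)^T = c *: M^T.
Proof. exact: linearZ. Qed.

(** * The 2-jet of a left-invariant metric *)

Section InvariantMetricJet.
Variables (R : realType) (n : nat) (mu : bracket R n) (g : metric R n).
Hypothesis mu_V : skew_bilinear mu.
Hypothesis mu_nil : nilpotent_bracket mu.
Hypothesis g_riem : riemannian_metric g.
Hypothesis g_inv : left_invariant mu g.

Let G := g 0.
Let P := invmx G.
Let A i := ad_mx mu (stdv R i).

(** Invariance under translation by [- x] is evaluated at [x], which this translation sends to the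
    origin. *)
Lemma left_invariantE x :
  g x = (jacobian_mx (bch mu (- x)) x)^T *m G *m jacobian_mx (bch mu (- x)) x.
Proof.
rewrite -[LHS](congr1 (fun f => f x) (g_inv (- x))) /pullback.
by rewrite (bch_opp_self mu_V).
Qed.

Let a x := ad_mx mu x.

Let taylor x : 'M[R]_n := G + (- 2^-1 *: ((a x)^T *m G + G *m a x)
  + (4^-1 *: ((a x)^T *m G *m a x)
  + 6^-1 *: ((a x *m a x)^T *m G + G *m (a x *m a x)))).

Lemma metric_taylor : exists2 rho, vanm 3 rho & forall x, g x = taylor x + rho x.
Proof.
have [r r3 Jr] := bch_jacobian_jet mu_V mu_nil.
have a1 : vanm 1 a by apply: (vanm_ad mu_V); exact: vanm_id.
pose u x := - 2^-1 *: a x; pose w x := 6^-1 *: (a x *m a x).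
have u1 : vanm 1 u by exact: vanmZ.
have w2 : vanm 2 w by apply: vanmZ; exact: (vanmM a1 a1).
have c0 (M : 'M[R]_n) : vanm 0 (fun _ : 'cV[R]_n => M) by exact: vanm_cst.
(* With J = 1 + u + w + r, of orders 0, 1, 2 and 3, these are the products in J^T G J of total order
   at least 3. *)
exists (fun x => (u x)^T *m G *m w x + (w x)^T *m G *m u x + (w x)^T *m G *m w x
   + (r x)^T *m G *m (1%:M + u x + w x + r x)
   + (1%:M + u x + w x)^T *m G *m r x).
  have J0 : vanm 0 (fun x => 1%:M + u x + w x).
    by apply: vanmD; [apply: vanmD => //; exact: vanm_le u1|exact: vanm_le w2].
  repeat apply: vanmD.
  - exact: (vanmM (vanmM (vanm_tr u1) (c0 G)) w2).
  - exact: (vanmM (vanmM (vanm_tr w2) (c0 G)) u1).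
  - by apply: vanm_le (vanmM (vanmM (vanm_tr w2) (c0 G)) w2).
  - apply: (vanmM (vanmM (vanm_tr r3) (c0 G))).
    by apply: vanmD => //; exact: vanm_le r3.
  - exact: (vanmM (vanmM (vanm_tr J0) (c0 G)) r3).
move=> x; rewrite left_invariantE Jr -/(a x) -scaleNr -/(u x) -/(w x).
rewrite /taylor -/(a x).
have -> : 4^-1 *: ((a x)^T *m G *m a x) = (u x)^T *m G *m u x.
  rewrite /u trmx_scale -!scalemxAl -scalemxAr scalerA; congr (_ *: _).
  by field.
have -> : 6^-1 *: ((a x *m a x)^T *m G + G *m (a x *m a x)) = (w x)^T *m G + G *m w x.
  by rewrite /w trmx_scale -scalemxAl -scalemxAr scalerDr.
have -> : - 2^-1 *: ((a x)^T *m G + G *m a x) = (u x)^T *m G + G *m u x.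
  by rewrite /u trmx_scale -scalemxAl -scalemxAr scalerDr.
move: (u x) (w x) (r x) => U W V.
rewrite !linearD /= trmx1 !(mulmxDl, mulmxDr) !mul1mx !mulmx1.
apply/matrixP => i j.
have addE (X Y : 'M[R]_n) : (X + Y) i j = X i j + Y i j by rewrite mxE.
by rewrite !addE; ring.
Qed.

Let a_line v x : dwithinmx setT (fun s => a (s *: v + x)) 0 (a v).
Proof. by apply: (dwithinmx_ad mu_V); exact: dwithinmx_line. Qed.

Let dtaylor l x : 'M[R]_n := jet1 G A l
  + (4^-1 *: ((A l)^T *m G *m a x + (a x)^T *m G *m A l)
  + 6^-1 *: ((A l *m a x + a x *m A l)^T *m G + G *m (A l *m a x + a x *m A l))).

Let dwithinmx_taylor l x :
  dwithinmx setT (fun s => taylor (s *: stdv R l + x)) 0 (dtaylor l x).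
Proof.
have L := @a_line (stdv R l) x; have LT := dwithinmx_tr L.
have LTG := dwithinmx_mulr G LT; have LL := dwithinmx_mul L L.
have := dwithinmx_add (dwithinmx_cst setT G 0) (dwithinmx_add
  (dwithinmx_scale (- 2^-1) (dwithinmx_add LTG (dwithinmx_mull G L)))
  (dwithinmx_add (dwithinmx_scale 4^-1 (dwithinmx_mul LTG L))
    (dwithinmx_scale 6^-1 (dwithinmx_add (dwithinmx_mulr G (dwithinmx_tr LL)) (dwithinmx_mull G LL))))).
by rewrite scale0r !add0r.
Qed.

Let dwithinmx_dtaylor l m :
  dwithinmx setT (fun s => dtaylor l (s *: stdv R m + 0)) 0 (jet2 G A m l).
Proof.
have L := @a_line (stdv R m) 0; have LT := dwithinmx_tr L.
have LL := dwithinmx_add (dwithinmx_mull (A l) L) (dwithinmx_mulr (A l) L).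
have := dwithinmx_add (dwithinmx_cst setT (jet1 G A l) 0) (dwithinmx_add
  (dwithinmx_scale 4^-1 (dwithinmx_add (dwithinmx_mull ((A l)^T *m G) L)
     (dwithinmx_mulr (A l) (dwithinmx_mulr G LT))))
  (dwithinmx_scale 6^-1 (dwithinmx_add (dwithinmx_mulr G (dwithinmx_tr LL)) (dwithinmx_mull G LL)))).
by rewrite add0r.
Qed.

(** Stated at every [x], because the partial derivative is differentiated once more. *)
Let taylor_entries i j l : exists2 rho, van 2 rho &
  forall x, partial l (fun y => g y i j) x = dtaylor l x i j + rho x.
Proof.
have [rho rho3 gE] := metric_taylor.
exists (fun x => 'D_(stdv R l) (fun y => rho y i j) x).
  exact: (van_derive (stdv R l) (rho3 i j)).
move=> x; apply: dwithin_derive.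
apply: dwithin_ext (dwithin_add (@dwithinmx_taylor l x i j)
  (derive_dwithin (van_derivable x (stdv R l) (rho3 i j)))) => s.
by rewrite gE [RHS]mxE.
Qed.

Lemma metric_partial i j l : partial l (fun y => g y i j) 0 = jet1 G A l i j.
Proof.
have [rho rho2 ->] := taylor_entries i j l.
rewrite (van_at0 rho2) addr0 /dtaylor /a (ad0 mu_V) trmx0.
by rewrite !(mulmx0, mul0mx, addr0, trmx0, scaler0).
Qed.

Lemma metric_partial2 i j m l :
  partial m (partial l (fun y => g y i j)) 0 = jet2 G A m l i j.
Proof.
have [rho rho2 E] := taylor_entries i j l.
have -> : partial l (fun y => g y i j) = fun x => dtaylor l x i j + rho x.
  exact/funext.
rewrite -[RHS]addr0 -(van_at0 (van_derive (stdv R m) rho2)).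
apply: dwithin_derive; apply: dwithin_add; first exact: dwithinmx_dtaylor.
exact: derive_dwithin (van_derivable 0 (stdv R m) rho2).
Qed.

Let g_unit x : g x \in unitmx.
Proof. by case: g_riem => H _; exact: inner_product_unit. Qed.

Lemma christoffel_at0 k i j : christoffel g k i j 0 = jet_gamma G P A k i j.
Proof.
by congr (_ * _); apply: eq_bigr => l _; rewrite !metric_partial.
Qed.

Lemma partial_christoffel_at0 m k i j :
  partial m (christoffel g k i j) 0 = jet_dgamma G P A m k i j.
Proof.
apply: dwithin_derive; apply: dwithin_scale; apply: dwithin_sum => l _.
have gm p q : dwithin setT (fun s => g (s *: stdv R m + 0) p q) 0 (jet1 G A m p q).
  rewrite -metric_partial; apply: (derive_dwithin (f := fun y => g y p q)).
  by apply: diff_derivable; case: g_riem => _ H; exact: (H p q [::]).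
have gmm p q r : dwithin setT (fun s => partial r (fun y => g y p q) (s *: stdv R m + 0)) 0
    (jet2 G A m r p q).
  rewrite -metric_partial2; apply: derive_dwithin.
  by apply: diff_derivable; case: g_riem => _ H; exact: (H p q [:: r]).
have inv := dwithinmx_invmx (fun s _ => g_unit (s *: stdv R m + 0)) (g_unit _)
  (gm : dwithinmx setT (fun s => g (s *: stdv R m + 0)) 0 (jet1 G A m)).
have := dwithin_mul (inv k l) (dwithin_sub (dwithin_add (gmm j l i) (gmm i l j)) (gmm i j l)).
by rewrite scale0r add0r !metric_partial.
Qed.

Lemma ricci_at0 j k : ricci_tensor g 0 j k =
  - 2^-1 * \tr (P *m (A j)^T *m G *m A k)
  - 4^-1 * \tr (P *m Kmx G A k *m P *m Kmx G A j).
Proof.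
rewrite -(@jet_ricci _ _ G P A).
- rewrite mxE; apply: eq_bigr => i _; rewrite /riemann !partial_christoffel_at0.
  by congr (_ + _); apply: eq_bigr => m _; rewrite !christoffel_at0.
- by case: g_riem => /(_ 0)[].
- exact: mulVmx (g_unit 0).
- by move=> i l p; rewrite !mxE (br_skew mu_V) mxE.
- by move=> i; exact: tr_ad.
- by move=> i l; exact: tr_ad_ad.
Qed.

End InvariantMetricJet.

Lemma row_mul_col (R : pzSemiRingType) m n p (A : 'M[R]_(m, n)) (B : 'M[R]_(n, p)) i j :
  (row i A *m col j B) 0 0 = (A *m B) i j.
Proof. by rewrite !mxE; apply: eq_bigr => k _; rewrite !mxE. Qed.

(** * Orthonormal frames, metric transposes and the lowered Ricci operator *)

Section Frames.
Variables (R : realType) (n : nat) (Q : 'M[R]_n) (e : 'I_n -> 'cV[R]_n).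
Hypothesis Q_ip : inner_product Q.
Hypothesis e_on : orthonormal_basis Q e.

Let Q_sym : Q^T = Q. Proof. by case: Q_ip. Qed.
Let Q_unit : Q \in unitmx. Proof. exact: inner_product_unit. Qed.

Lemma invmx_sym : (invmx Q)^T = invmx Q.
Proof. by rewrite trmx_inv Q_sym. Qed.

(** For the matrix M with columns [e i], orthonormality reads M^T Q M = 1, and a one-sided inverse
    is two-sided. Through this, sums over the frame become traces in which the frame no longer
    appears. *)
Lemma frame_sum : \sum_i e i *m (e i)^T = invmx Q.
Proof.
pose M : 'M[R]_n := \matrix_(k, i) e i k 0.
have cM i : col i M = e i.
  by apply/colP => k; rewrite !mxE.
have MQM : M^T *m Q *m M = 1%:M.
  apply/matrixP => i j; rewrite [RHS]mxE -e_on /ip -(cM i) -(cM j) tr_col.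
  by rewrite -row_mul row_mul_col.
have -> : \sum_i e i *m (e i)^T = M *m M^T.
  apply/matrixP => i j; rewrite summxE mxE; apply: eq_bigr => k _.
  by rewrite !mxE big_ord1 !mxE.
rewrite -[LHS]mulmx1 -(mulmxV Q_unit) mulmxA -(mulmxA M).
by rewrite (mulmx1C MQM) mul1mx.
Qed.

Lemma frame_trace (M : 'M[R]_n) :
  \sum_i ((e i)^T *m M *m e i) 0 0 = \tr (M *m invmx Q).
Proof.
rewrite -frame_sum mulmx_sumr raddf_sum /=; apply: eq_bigr => i _.
by rewrite mulmxA [RHS]mxtrace_mulC mulmxA /mxtrace big_ord1.
Qed.

Lemma frame_decomp v : v = \sum_i ip Q (e i) v *: e i.
Proof.
rewrite -[LHS]mul1mx -(mulVmx Q_unit) -frame_sum !mulmx_suml.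
apply: eq_bigr => i _; rewrite /ip -!mulmxA.
by rewrite [X in _ *m X]mx11_scalar mul_mx_scalar !mulmxA.
Qed.

Lemma transpM A B : transp Q (A *m B) = transp Q B *m transp Q A.
Proof. by rewrite /transp trmx_mul !mulmxA (mulmxK Q_unit). Qed.

Lemma transpK A : transp Q (transp Q A) = A.
Proof.
rewrite /transp !trmx_mul trmxK invmx_sym Q_sym !mulmxA (mulVmx Q_unit) mul1mx.
by rewrite (mulmxKV Q_unit).
Qed.

Lemma transpD A B : transp Q (A + B) = transp Q A + transp Q B.
Proof. by rewrite /transp linearD mulmxDr mulmxDl. Qed.

Lemma transpZ c A : transp Q (c *: A) = c *: transp Q A.
Proof. by rewrite /transp trmx_scale -scalemxAr -scalemxAl. Qed.

Lemma transp0 : transp Q 0 = 0.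
Proof. by rewrite /transp trmx0 mulmx0 mul0mx. Qed.

Lemma transp_sum (I : Type) (r : seq I) (P : pred I) f :
  transp Q (\sum_(i <- r | P i) f i) = \sum_(i <- r | P i) transp Q (f i).
Proof. exact: (big_morph _ transpD transp0). Qed.

Lemma tr_transp A : \tr (transp Q A) = \tr A.
Proof. by rewrite /transp mxtrace_mulC mulmxA (mulmxV Q_unit) mul1mx mxtrace_tr. Qed.

Lemma frame_ip A B : \sum_j ip Q (A *m e j) (B *m e j) = \tr (transp Q B *m A).
Proof.
transitivity (\sum_j ((e j)^T *m (A^T *m Q *m B) *m e j) 0 0).
  by apply: eq_bigr => j _; rewrite /ip trmx_mul !mulmxA.
rewrite frame_trace -mxtrace_tr /transp !trmx_mul trmxK invmx_sym Q_sym.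
by rewrite !mulmxA.
Qed.

Lemma Ric_selfadjoint mu : transp Q (Ric Q e mu) = Ric Q e mu.
Proof.
rewrite /Ric transpD !transpZ !transp_sum.
by congr (_ *: _ + _ *: _); apply: eq_bigr => i _; rewrite transpM transpK.
Qed.

Section LoweredRicci.
Variable mu : bracket R n.
Hypothesis mu_V : skew_bilinear mu.
Let A i := ad_mx mu (stdv R i).
Let P := invmx Q.

(** Linearity and skew-symmetry turn the frame vector, a direction of [ad], into an argument: column
    l of [ad_mx mu (e i)] is [- (A l *m e i)], and row l of [Q *m ad_mx mu (e i)] is the transpose
    of [Kmx Q A l *m e i]. Both sums are then frame traces. *)
Lemma Ric_lower j k : (Q *m Ric Q e mu) j k =
  - 2^-1 * \tr (P *m (A j)^T *m Q *m A k)
  - 4^-1 * \tr (P *m Kmx Q A k *m P *m Kmx Q A j).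
Proof.
have QT M : Q *m transp Q M = M^T *m Q by rewrite /transp !mulmxA (mulmxV Q_unit) mul1mx.
rewrite /Ric mulmxDr -!scalemxAr mxE [X in X + _]mxE [X in _ + X]mxE.
rewrite -mulrN; congr (_ * _ + _ * _).
  rewrite mulmx_sumr summxE.
  transitivity (\sum_i ((e i)^T *m ((A j)^T *m Q *m A k) *m e i) 0 0).
    apply: eq_bigr => i _; rewrite [in LHS]mulmxA QT.
    have adA l : col l (ad_mx mu (e i)) = - (A l *m e i).
      by rewrite ad_stdv /A -(br_ad mu_V) -(br_skew mu_V).
    transitivity (((col j (ad_mx mu (e i)))^T *m Q *m col k (ad_mx mu (e i))) 0 0).
      by rewrite tr_col -row_mul row_mul_col.
    by rewrite !adA -scaleN1r trmx_scale scaleN1r trmx_mul mulmxN !mulNmx opprK !mulmxA.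
  by rewrite frame_trace mxtrace_mulC !mulmxA.
rewrite mulmx_sumr summxE.
transitivity (\sum_i ((e i)^T *m ((Kmx Q A j)^T *m P *m Kmx Q A k) *m e i) 0 0).
  apply: eq_bigr => i _.
  have KA l : (row l (Q *m ad_mx mu (e i)))^T = Kmx Q A l *m e i.
    apply/colP => m; rewrite {1}[e i]stdv_decomp (ad_sum mu_V) mulmx_sumr.
    rewrite mxE mxE summxE mxE; apply: eq_bigr => a _.
    by rewrite (adZ mu_V) -scalemxAr mxE [Kmx _ _ _ _ _]mxE mulrC.
  have -> : (Q *m (ad_mx mu (e i) *m transp Q (ad_mx mu (e i)))) j k =
      (row j (Q *m ad_mx mu (e i)) *m P *m (row k (Q *m ad_mx mu (e i)))^T) 0 0.
    by rewrite tr_row -row_mul row_mul_col /transp trmx_mul Q_sym !mulmxA.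
  by rewrite -[row j _]trmxK !KA trmx_mul !mulmxA.
rewrite frame_trace.
have -> : (Kmx Q A j)^T = - Kmx Q A j.
  apply/matrixP => a b; rewrite [LHS]mxE [LHS]mxE [RHS]mxE [X in _ = - X]mxE !mxE -sumrN.
  by apply: eq_bigr => c _; rewrite !mxE (br_skew mu_V) mxE mulrN.
rewrite !mulNmx raddfN /=; congr (- _).
by rewrite -!mulmxA mxtrace_mulC !mulmxA mxtrace_mulC !mulmxA.
Qed.

End LoweredRicci.
End Frames.

Section RicciOperator.
Variables (R : realType) (n : nat) (mu : bracket R n) (g : metric R n).
Hypothesis mu_V : skew_bilinear mu.
Hypothesis mu_nil : nilpotent_bracket mu.
Hypothesis g_riem : riemannian_metric g.
Hypothesis g_inv : left_invariant mu g.

Lemma ricci_operator_at0 f : orthonormal_basis (g 0) f ->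
  ricci_operator g 0 = Ric (g 0) f mu.
Proof.
move=> f_on; have g0_ip : inner_product (g 0) by case: g_riem.
have -> : ricci_operator g 0 = invmx (g 0) *m (g 0 *m Ric (g 0) f mu).
  congr (_ *m _); apply/matrixP => j k.
  by rewrite (Ric_lower g0_ip f_on mu_V) (ricci_at0 mu_V mu_nil g_riem g_inv).
by rewrite mulKmx // inner_product_unit.
Qed.

Lemma ricci_tensor_sym : (ricci_tensor g 0)^T = ricci_tensor g 0.
Proof.
have [g0_sym _] : inner_product (g 0) by case: g_riem.
apply/matrixP => j k; rewrite mxE !(ricci_at0 mu_V mu_nil g_riem g_inv).
congr (_ * _ - _ * _).
  rewrite -[LHS]mxtrace_tr !trmx_mul trmxK g0_sym trmx_inv g0_sym.
  by rewrite !mulmxA mxtrace_mulC !mulmxA.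
by rewrite -!mulmxA mxtrace_mulC -!mulmxA [in LHS]mxtrace_mulC !mulmxA mxtrace_mulC !mulmxA.
Qed.

End RicciOperator.

(** * The Ricci operator under change of basis *)

Section RicAction.
Variables (R : realType) (n : nat) (Q h : 'M[R]_n) (e : 'I_n -> 'cV[R]_n).
Variable mu : bracket R n.
Hypothesis h_unit : h \in unitmx.
Hypothesis Q_unit : Q \in unitmx.
Let G := h^T *m Q *m h.

Lemma orthonormal_pullback : orthonormal_basis Q e ->
  orthonormal_basis G (fun i => invmx h *m e i).
Proof.
move=> e_on i j; rewrite -e_on /ip /G trmx_mul !mulmxA.
by rewrite -[_ *m h^T]mulmxA -trmx_mul mulmxV // trmx1 mulmx1 (mulmxK h_unit).
Qed.

Lemma ad_act x : skew_bilinear mu ->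
  ad_mx (act mu h) x = h *m ad_mx mu (invmx h *m x) *m invmx h.
Proof.
move=> mu_V; apply/matrixP => k j; rewrite mxE /act (br_ad mu_V).
by rewrite /stdv !mulmxA -colE mxE.
Qed.

(** The map [h] carries the form [G] to [Q] and [mu] to [act mu h], so conjugation by [h] respects
    both [ad] and the metric transposes. *)
Lemma Ric_act : skew_bilinear mu ->
  Ric Q e (act mu h) = h *m Ric G (fun i => invmx h *m e i) mu *m invmx h.
Proof.
move=> mu_V.
have T X : transp Q (h *m X *m invmx h) = h *m transp G X *m invmx h.
  have GI : invmx G = invmx h *m invmx Q *m (invmx h)^T.
    have G_unit : G \in unitmx by rewrite /G !unitmx_mul unitmx_tr h_unit Q_unit.
    have E : invmx h *m invmx Q *m (invmx h)^T *m G = 1%:M.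
      rewrite /G !mulmxA -[_ *m (invmx h)^T *m h^T]mulmxA -trmx_mul.
      by rewrite mulmxV // trmx1 mulmx1 mulmxKV // mulVmx.
    by rewrite -[LHS]mul1mx -E mulmxK.
  rewrite /transp GI /G !trmx_mul !mulmxA (mulmxV h_unit) mul1mx.
  by rewrite (mulmxK h_unit).
rewrite /Ric mulmxDr mulmxDl -!scalemxAr -!scalemxAl.
congr (_ *: _ + _ *: _); rewrite mulmx_sumr mulmx_suml; apply: eq_bigr => i _.
  by rewrite (ad_act _ mu_V) T !mulmxA (mulmxKV h_unit).
by rewrite (ad_act _ mu_V) T !mulmxA (mulmxKV h_unit).
Qed.

End RicAction.

(** * The gradient of F *)

Section GradientOfF.
Variables (R : realType) (n : nat) (Q : 'M[R]_n) (e : 'I_n -> 'cV[R]_n).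
Hypothesis Q_ip : inner_product Q.
Hypothesis e_on : orthonormal_basis Q e.

(** The infinitesimal form of [act]; it vanishes exactly when [A] is a derivation of [mu]. *)
Definition gl_act (A : 'M[R]_n) (mu : bracket R n) : bracket R n :=
  fun x y => A *m mu x y - mu (A *m x) y - mu x (A *m y).

Definition gradF (mu : bracket R n) := gl_act (Ric Q e mu) mu.

Lemma gl_act_skew A mu : skew_bilinear mu -> skew_bilinear (gl_act A mu).
Proof.
move=> mu_V.
have S x y : gl_act A mu x y = - gl_act A mu y x.
  rewrite /gl_act (br_skew mu_V x y) (br_skew mu_V (A *m x) y) (br_skew mu_V x (A *m y)).
  by rewrite mulmxN; apply/colP => k; rewrite !mxE; ring.
have L x : linear (gl_act A mu x).
  move=> c u v; rewrite /gl_act !(mulmxDr, brDr mu_V) -!scalemxAr !(brZr mu_V).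
  rewrite -!scalemxAr.
  by apply/colP => k; rewrite !mxE; ring.
split => // y c u v.
by rewrite S L opprD -scalerN -!S.
Qed.

Lemma bracket_add_skew (mu lam : bracket R n) (s : R) : skew_bilinear mu -> skew_bilinear lam ->
  skew_bilinear (fun x y => mu x y + s *: lam x y).
Proof.
move=> mu_V lam_V; split.
- move=> x c u v; rewrite !(brDr mu_V, brDr lam_V, brZr mu_V, brZr lam_V).
  by apply/colP => k; rewrite !mxE; ring.
- move=> x c u v; rewrite !(brDl mu_V, brDl lam_V, brZl mu_V, brZl lam_V).
  by apply/colP => k; rewrite !mxE; ring.
- by move=> x y; rewrite (br_skew mu_V) (br_skew lam_V) scalerN opprD.
Qed.

Lemma dwithinmx_Ric J (nu : R -> bracket R n) t (b : 'I_n -> 'M[R]_n) :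
  (forall i, dwithinmx J (fun s => ad_mx (nu s) (e i)) t (b i)) ->
  let a i := ad_mx (nu t) (e i) in
  dwithinmx J (fun s => Ric Q e (nu s)) t
    (- 2^-1 *: (\sum_i (transp Q (b i) *m a i + transp Q (a i) *m b i))
    + 4^-1 *: (\sum_i (b i *m transp Q (a i) + a i *m transp Q (b i)))).
Proof.
move=> H a.
have HT i : dwithinmx J (fun s => transp Q (ad_mx (nu s) (e i))) t (transp Q (b i)).
  by apply: dwithinmx_mulr; apply: dwithinmx_mull; apply: dwithinmx_tr.
apply: dwithinmx_add; apply: dwithinmx_scale; apply: dwithinmx_sum => i _.
  exact: dwithinmx_mul (HT i) (H i).
exact: dwithinmx_mul (H i) (HT i).
Qed.

Lemma tr_Ric_derivative (mu lam : bracket R n) : skew_bilinear mu -> skew_bilinear lam ->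
  let a i := ad_mx mu (e i) in let b i := ad_mx lam (e i) in
  2 * \tr (Ric Q e mu *m
    (- 2^-1 *: (\sum_i (transp Q (b i) *m a i + transp Q (a i) *m b i))
    + 4^-1 *: (\sum_i (b i *m transp Q (a i) + a i *m transp Q (b i))))) =
  bracket_ip Q e (gradF mu) lam.
Proof.
move=> mu_V lam_V a b; rewrite /gradF.
(* Both sides are linear in this occurrence of the Ricci operator, and of the operator only
   self-adjointness matters from here on. *)
have := Ric_selfadjoint e Q_ip mu; move: (Ric Q e mu) => r rT.
have trT A := tr_transp Q_ip A.
transitivity (\sum_i (\tr (transp Q (b i) *m r *m a i)
    - 2 * \tr (transp Q (b i) *m a i *m r))).
  rewrite mulmxDr -!scalemxAr raddfD /= !mxtraceZ !mulmx_sumr !raddf_sum /=.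
  rewrite !mulr_sumr -big_split mulr_sumr; apply: eq_bigr => i _.
  rewrite !mulmxDr !raddfD /=.
  have -> : \tr (r *m (transp Q (a i) *m b i)) = \tr (transp Q (b i) *m a i *m r).
    by rewrite -[LHS]trT (transpM Q_ip r) (transpM Q_ip _ (b i)) (transpK Q_ip) rT.
  have -> : \tr (r *m (transp Q (b i) *m a i)) = \tr (transp Q (b i) *m a i *m r).
    by rewrite mxtrace_mulC.
  have -> : \tr (r *m (b i *m transp Q (a i))) = \tr (transp Q (b i) *m r *m a i).
    rewrite -[LHS]trT (transpM Q_ip r) (transpM Q_ip (b i)) (transpK Q_ip) rT.
    by rewrite -mulmxA mxtrace_mulC -!mulmxA.
  have -> : \tr (r *m (a i *m transp Q (b i))) = \tr (transp Q (b i) *m r *m a i).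
    by rewrite mulmxA mxtrace_mulC mulmxA.
  by rewrite /=; field.
have ipB (x y z : 'cV[R]_n) : ip Q (x - y) z = ip Q x z - ip Q y z.
  by rewrite /ip linearB /= !mulmxBl !mxE.
have -> : bracket_ip Q e (gl_act r mu) lam =
    \sum_i \sum_j ip Q (r *m mu (e i) (e j)) (lam (e i) (e j))
    - \sum_i \sum_j ip Q (mu (r *m e i) (e j)) (lam (e i) (e j))
    - \sum_i \sum_j ip Q (mu (e i) (r *m e j)) (lam (e i) (e j)).
  rewrite -!sumrB; apply: eq_bigr => i _; rewrite -!sumrB; apply: eq_bigr => j _.
  by rewrite -!ipB.
have ipNN (x y : 'cV[R]_n) : ip Q (- x) (- y) = ip Q x y.
  by rewrite /ip -[- x]scaleN1r trmx_scale scaleN1r mulmxN !mulNmx opprK.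
(* The two slots of the bracket contribute equally by skew-symmetry; this is the factor 2 above. *)
have -> : \sum_i \sum_j ip Q (mu (r *m e i) (e j)) (lam (e i) (e j)) =
    \sum_i \sum_j ip Q (mu (e i) (r *m e j)) (lam (e i) (e j)).
  rewrite exchange_big; apply: eq_bigr => i _; apply: eq_bigr => j _.
  by rewrite (br_skew mu_V) (br_skew lam_V) ipNN.
rewrite -addrA -opprD -big_split -sumrB; apply: eq_bigr => i _ /=.
rewrite -mulr2n -[in RHS]mulr_natl; congr (_ - _ * _).
  transitivity (\sum_j ip Q ((r *m a i) *m e j) (b i *m e j)).
    by rewrite (frame_ip Q_ip e_on) mulmxA.
  by apply: eq_bigr => j _; rewrite (br_ad mu_V) (br_ad lam_V) mulmxA.
transitivity (\sum_j ip Q ((a i *m r) *m e j) (b i *m e j)).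
  by rewrite (frame_ip Q_ip e_on) mulmxA.
by apply: eq_bigr => j _; rewrite (br_ad mu_V) (br_ad lam_V) mulmxA.
Qed.

Lemma is_gradient_gradF mu : skew_bilinear mu ->
  is_gradient Q e (F Q e) mu (gradF mu).
Proof.
move=> mu_V; split=> [|lam lam_V]; first exact: gl_act_skew.
rewrite -tr_Ric_derivative //.
pose nu s : bracket R n := fun x y => mu x y + s *: lam x y.
have nu0 : nu 0 = mu by apply/funext => x; apply/funext => y; rewrite /nu scale0r addr0.
have H i : dwithinmx setT (fun s => ad_mx (nu s) (e i)) 0 (ad_mx lam (e i)).
  move=> k j.
  have := dwithin_add (dwithin_cst setT (ad_mx mu (e i) k j) 0)
    (dwithin_mul (dwithin_id setT 0) (dwithin_cst setT (ad_mx lam (e i) k j) 0)).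
  by rewrite mul1r mulr0 addr0 add0r; apply: dwithin_ext => s; rewrite !mxE.
have D := dwithinmx_Ric H; rewrite nu0 in D.
apply/is_derive_dwithin.
have := dwithin_mxtrace (dwithinmx_mul D D); rewrite nu0 raddfD /= mxtrace_mulC -mulr2n mulr_natl.
by apply: dwithin_ext => s; rewrite addr0 [s *: 1]mulr1.
Qed.

Lemma bracket_ip_eq0 (G : bracket R n) : skew_bilinear G ->
  bracket_ip Q e G G = 0 -> forall x y, G x y = 0.
Proof.
move=> G_V G0 x y.
have Qpos u : 0 <= ip Q u u.
  have [->|u0] := eqVneq u 0; first by rewrite /ip mulmx0 mxE.
  by case: Q_ip => _ /(_ u u0)/ltW.
have Gee i j : G (e i) (e j) = 0.
  have /eqP := G0; rewrite psumr_eq0; last by move=> a _; apply: sumr_ge0.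
  move=> /allP/(_ i (mem_index_enum _))/=; rewrite psumr_eq0 //.
  move=> /allP/(_ j (mem_index_enum _))/= /eqP G00.
  apply/eqP/negPn/negP => /(proj2 Q_ip); rewrite -/(ip Q _ _) G00.
  by rewrite ltxx.
rewrite (frame_decomp Q_ip e_on x) (br_ad G_V) (ad_sum G_V) mulmx_suml.
rewrite big1 // => i _; rewrite (adZ G_V) -scalemxAl -(br_ad G_V).
rewrite (frame_decomp Q_ip e_on y) (br_sumr G_V) big1 ?scaler0 // => j _.
by rewrite (brZr G_V) Gee scaler0.
Qed.

(** The difference of two gradients is orthogonal to itself. A solution of [neg_gradient_flow] only
    comes with some gradient at each time; identifying it with [gradF] turns the flow into an
    explicit polynomial equation. *)
Lemma gradient_uniq f mu G G' : is_gradient Q e f mu G ->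
  is_gradient Q e f mu G' -> forall x y, G x y = G' x y.
Proof.
move=> [G_V HG] [G'_V HG'] x y.
pose D : bracket R n := fun x y => G x y + (-1) *: G' x y.
have D_V : skew_bilinear D by exact: bracket_add_skew.
have ipE : bracket_ip Q e G D = bracket_ip Q e G' D.
  have [_ <-] := HG D D_V; by have [_ <-] := HG' D D_V.
have := @bracket_ip_eq0 D D_V; rewrite /D => H; apply/eqP; rewrite -subr_eq0 -scaleN1r.
apply/eqP; apply: H; rewrite -/D.
transitivity (bracket_ip Q e G D - bracket_ip Q e G' D); last by rewrite ipE subrr.
rewrite /bracket_ip -sumrB; apply: eq_bigr => i _; rewrite -sumrB.
apply: eq_bigr => j _; rewrite /ip /D scaleN1r.
by rewrite [(_ - _)^T]linearB /= !mulmxBl !mxE.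
Qed.

End GradientOfF.

(** * Uniqueness of the gradient flow *)

Section RelativeMonotonicity.
Variable R : realType.

Lemma dwithin_subset (J J' : set R) f t l : J' `<=` J -> dwithin J f t l -> dwithin J' f t l.
Proof.
move=> sJ; apply: cvg_trans; apply: cvg_app => A; rewrite /within /nbhs /= => H.
by apply: filterS H => s As /sJ/As.
Qed.

Lemma dwithin_of_is_derive (J : set R) f (t l : R) : is_derive t 1 f l -> dwithin J f t l.
Proof.
move=> /is_derive_dwithin H; apply: (@dwithin_subset setT) => //.
rewrite /dwithin.
have E : (fun s => (s - t)^-1 * (f s - f t)) =
    (fun h => (h - 0)^-1 * (f (h *: 1 + t) - f (0 *: 1 + t))) \o (fun s => s - t).
  by apply/funext => s /=; rewrite subr0 scale0r add0r [_ *: 1]mulr1 subrK.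
rewrite E; apply: cvg_comp H => A; rewrite /within /=.
move=> [r r0 HA]; exists r => // s /= sr st _.
by apply: HA => //=; [rewrite sub0r normrN distrC|rewrite subr_eq0].
Qed.

Lemma is_derive_of_dwithin a b (f : R -> R) x l : a < x < b ->
  dwithin `[a, b]%classic f x l -> is_derive x 1 f l.
Proof.
move=> /andP[ax xb] H; apply/is_derive_dwithin; rewrite /dwithin.
have E : (fun h : R => (h - 0)^-1 * (f (h *: 1 + x) - f (0 *: 1 + x))) =
    (fun s => (s - x)^-1 * (f s - f x)) \o (fun h => h + x).
  by apply/funext => s /=; rewrite subr0 scale0r add0r [_ *: 1]mulr1 addrK.
rewrite E; apply: cvg_comp H => A; rewrite /within /=.
move=> [r r0 HA]; have m0 : 0 < Num.min r (Num.min (x - a) (b - x)).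
  by rewrite !lt_min r0 !subr_gt0 ax xb.
exists (Num.min r (Num.min (x - a) (b - x))) => // h /=.
rewrite sub0r normrN !lt_min ltr_norml => /and3P[/andP[h1 h2]].
rewrite ltr_norml => /andP[h3 h4]; rewrite ltr_norml => /andP[h5 h6] h0 _.
apply: HA => /=; last by rewrite in_itv /=; apply/andP; split; lra.
  by rewrite ltr_norml; apply/andP; split; lra.
by rewrite -subr_eq0 addrK.
Qed.

Lemma dwithin_continuous a b (f l : R -> R) :
  (forall x, a <= x <= b -> dwithin `[a, b]%classic f x (l x)) ->
  {within `[a, b]%classic, continuous f}.
Proof.
move=> H; apply/subspace_continuousP => x; rewrite /= in_itv /= => xab.
move=> B Bx; have := dwithin_cvg (H x xab) Bx; rewrite /within /= => HB.
have HB' : nbhs x (fun s => s != x -> `[a, b]%classic s -> B (f s)) := HB.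
have : nbhs x (fun s => `[a, b]%classic s -> B (f s)); last by [].
apply: filterS HB' => s Bs sab; have [->|sx] := eqVneq s x.
  exact: nbhs_singleton.
exact: Bs.
Qed.

Lemma dwithin_MVT a b (f l : R -> R) : a <= b ->
  (forall x, a <= x <= b -> dwithin `[a, b]%classic f x (l x)) ->
  exists2 c, a <= c <= b & f b - f a = l c * (b - a).
Proof.
move=> ab H.
have D x : x \in `]a, b[ -> is_derive x 1 f (l x).
  rewrite in_itv /= => xab; apply: (is_derive_of_dwithin xab).
  by apply: H; move/andP: xab => [/ltW -> /ltW ->].
have [c cab E] := MVT_segment ab D (dwithin_continuous H).
by exists c => //; rewrite in_itv in cab.
Qed.

Lemma dwithin_bounded a b (f l : R -> R) : a <= b ->
  (forall x, a <= x <= b -> dwithin `[a, b]%classic f x (l x)) ->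
  exists2 C, 0 <= C & forall x, a <= x <= b -> `|f x| <= C.
Proof.
move=> ab H; have cf := dwithin_continuous H.
have [c _ Hc] := EVT_max ab cf; have [d _ Hd] := EVT_min ab cf.
exists (`|f c| + `|f d|); first by rewrite addr_ge0.
move=> x xab; have xI : x \in `[a, b] by rewrite in_itv.
have := Hc x xI; have := Hd x xI => h1 h2.
rewrite ler_norml; apply/andP; split.
  have := ler_norm (- f d); rewrite normrN; have := normr_ge0 (f c); lra.
have := ler_norm (f c); have := normr_ge0 (f d); lra.
Qed.

Lemma dwithin_expR (J : set R) c t :
  dwithin J (fun s => expR (c * s)) t (c * expR (c * t)).
Proof.
apply: dwithin_of_is_derive.
have H : is_derive t 1 (fun s : R => c * s) c.
  apply/is_derive_dwithin.
  have := dwithin_scale c (dwithin_add (dwithin_id setT 0) (dwithin_cst setT t 0)).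
  by rewrite addr0 mulr1; apply: dwithin_ext => s; rewrite [_ *: 1]mulr1.
have := is_derive1_comp (is_derive_expR (c * t)) H.
by rewrite mulrC.
Qed.

(** The function w e^(-Ct) is nonincreasing and w e^(Ct) is nondecreasing. Both directions serve,
    since J may extend to either side of 0. *)
Lemma dwithin_gronwall a b (w w' : R -> R) C : a <= b ->
  (forall x, a <= x <= b -> dwithin `[a, b]%classic w x (w' x)) ->
  (forall x, a <= x <= b -> 0 <= w x) ->
  (forall x, a <= x <= b -> `|w' x| <= C * w x) ->
  w a = 0 \/ w b = 0 -> w a = 0 /\ w b = 0.
Proof.
move=> ab H w0 Hw.
have aab : a <= a <= b by rewrite lexx.
have bab : a <= b <= b by rewrite lexx andbT.
have fwd : w b * expR (- C * b) <= w a * expR (- C * a).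
  have [|c cab E] := @dwithin_MVT a b (fun s => w s * expR (- C * s))
     (fun s => w' s * expR (- C * s) + w s * (- C * expR (- C * s))) ab.
    by move=> x xab; apply: dwithin_mul; [exact: H|exact: dwithin_expR].
  rewrite -subr_le0 E; apply: mulr_le0_ge0; last by rewrite subr_ge0.
  rewrite mulrCA mulNr mulrA -mulNr -mulrDl.
  apply: mulr_le0_ge0; last exact: expR_ge0.
  have := Hw c cab; have := ler_norm (w' c); rewrite mulrC; lra.
have bwd : w a * expR (C * a) <= w b * expR (C * b).
  have [|c cab E] := @dwithin_MVT a b (fun s => w s * expR (C * s))
     (fun s => w' s * expR (C * s) + w s * (C * expR (C * s))) ab.
    by move=> x xab; apply: dwithin_mul; [exact: H|exact: dwithin_expR].
  rewrite -subr_ge0 E; apply: mulr_ge0; last by rewrite subr_ge0.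
  rewrite mulrCA mulrA -mulrDl.
  apply: mulr_ge0; last exact: expR_ge0.
  have := Hw c cab; have := ler_norm (- w' c); rewrite normrN mulrC; lra.
have z x y : 0 <= x -> x * expR y <= 0 -> x = 0.
  by move=> x0; rewrite pmulr_lle0 ?expR_gt0 // => x1; apply/eqP; rewrite eq_le x0 x1.
case=> E; rewrite E mul0r in fwd; rewrite E mul0r in bwd; split => //.
  exact: z _ _ (w0 b bab) fwd.
exact: z _ _ (w0 a aab) bwd.
Qed.

End RelativeMonotonicity.

(** * Lipschitz bounds for polynomial expressions *)

Section LipschitzPairs.
Variables (R : realType) (I : set R) (d : R -> R).

(* f and g are the values of one polynomial expression along two bounded
   curves at distance at most d. *)
Definition lip2 (f g : R -> R) := exists2 C, 0 <= C &
  forall s, I s -> [/\ `|f s| <= C, `|g s| <= C & `|f s - g s| <= C * d s].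

Hypothesis d_ge0 : forall s, I s -> 0 <= d s.

Lemma lip2_cst c : lip2 (fun=> c) (fun=> c).
Proof.
exists `|c| => // s Is; split => //.
by rewrite subrr normr0 mulr_ge0 // d_ge0.
Qed.

Lemma lip2D f g f' g' : lip2 f g -> lip2 f' g' ->
  lip2 (fun s => f s + f' s) (fun s => g s + g' s).
Proof.
move=> [C C0 H] [C' C0' H']; exists (C + C'); first exact: addr_ge0.
move=> s Is; have [h1 h2 h3] := H s Is; have [k1 k2 k3] := H' s Is; split.
- by apply: le_trans (ler_normD _ _) _; exact: lerD.
- by apply: le_trans (ler_normD _ _) _; exact: lerD.
- rewrite opprD addrACA mulrDl.
  by apply: le_trans (ler_normD _ _) _; exact: lerD.
Qed.

Lemma lip2M f g f' g' : lip2 f g -> lip2 f' g' ->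
  lip2 (fun s => f s * f' s) (fun s => g s * g' s).
Proof.
(* One constant serves all three bounds: the products are at most C C', and their difference costs 2
   C C'. *)
move=> [C C0 H] [C' C0' H']; exists (2 * C * C' + C * C').
  by rewrite addr_ge0 ?mulr_ge0.
move=> s Is; have [h1 h2 h3] := H s Is; have [k1 k2 k3] := H' s Is.
have CC : 0 <= C * C' by rewrite mulr_ge0.
split.
- rewrite normrM; apply: le_trans (ler_pM _ _ h1 k1) _ => //; lra.
- rewrite normrM; apply: le_trans (ler_pM _ _ h2 k2) _ => //; lra.
- have -> : f s * f' s - g s * g' s = (f s - g s) * f' s + g s * (f' s - g' s).
    by ring.
  apply: le_trans (ler_normD _ _) _; rewrite !normrM.
  have p1 := ler_pM (normr_ge0 _) (normr_ge0 _) h3 k1.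
  have p2 := ler_pM (normr_ge0 _) (normr_ge0 _) h2 k3.
  apply: le_trans (lerD p1 p2) _.
  have -> : C * d s * C' + C * (C' * d s) = (2 * C * C') * d s by ring.
  by rewrite ler_wpM2r ?d_ge0 // lerDl.
Qed.

Lemma lip2_ext f g f' g' : f =1 f' -> g =1 g' -> lip2 f g -> lip2 f' g'.
Proof. by move=> /funext -> /funext ->. Qed.

Lemma lip2_sum (T : Type) (r : seq T) (P : pred T) (f g : T -> R -> R) :
  (forall i, P i -> lip2 (f i) (g i)) ->
  lip2 (fun s => \sum_(i <- r | P i) f i s) (fun s => \sum_(i <- r | P i) g i s).
Proof.
move=> H; elim: r => [|i r IH].
  apply: lip2_ext (lip2_cst 0) => s; by rewrite big_nil.
case: (boolP (P i)) => Pi.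
  by apply: lip2_ext (lip2D (H i Pi) IH) => s; rewrite big_cons Pi.
by apply: lip2_ext IH => s; rewrite big_cons (negbTE Pi).
Qed.

Definition lipm p q (A B : R -> 'M[R]_(p, q)) :=
  forall i j, lip2 (fun s => A s i j) (fun s => B s i j).

Lemma lipm_cst p q (A : 'M[R]_(p, q)) : lipm (fun=> A) (fun=> A).
Proof. by move=> i j; exact: lip2_cst. Qed.

Lemma lipmD p q (A B A' B' : R -> 'M[R]_(p, q)) : lipm A B -> lipm A' B' ->
  lipm (fun s => A s + A' s) (fun s => B s + B' s).
Proof.
move=> H H' i j.
by apply: lip2_ext (lip2D (H i j) (H' i j)) => s; rewrite mxE.
Qed.

Lemma lipmZ c p q (A B : R -> 'M[R]_(p, q)) : lipm A B ->
  lipm (fun s => c *: A s) (fun s => c *: B s).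
Proof.
move=> H i j.
by apply: lip2_ext (lip2M (lip2_cst c) (H i j)) => s; rewrite mxE.
Qed.

Lemma lipmM p q r (A B : R -> 'M[R]_(p, q)) (A' B' : R -> 'M[R]_(q, r)) :
  lipm A B -> lipm A' B' -> lipm (fun s => A s *m A' s) (fun s => B s *m B' s).
Proof.
move=> H H' i j.
apply: (lip2_ext _ _ (lip2_sum (index_enum _) (P := xpredT)
  (fun k _ => lip2M (H i k) (H' k j)))) => s; by rewrite mxE.
Qed.

Lemma lipm_tr p q (A B : R -> 'M[R]_(p, q)) : lipm A B ->
  lipm (fun s => (A s)^T) (fun s => (B s)^T).
Proof. by move=> H i j; apply: lip2_ext (H j i) => s; rewrite mxE. Qed.

Lemma lipm_sum p q (T : Type) (r : seq T) (P : pred T)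
    (A B : T -> R -> 'M[R]_(p, q)) : (forall i, P i -> lipm (A i) (B i)) ->
  lipm (fun s => \sum_(i <- r | P i) A i s) (fun s => \sum_(i <- r | P i) B i s).
Proof.
move=> H i j.
apply: (lip2_ext _ _ (lip2_sum r (fun k Pk => H k Pk i j))) => s;
  by rewrite summxE.
Qed.

End LipschitzPairs.

Section FlowUniqueness.
Variables (R : realType) (n : nat) (Q : 'M[R]_n) (e : 'I_n -> 'cV[R]_n).
Hypothesis Q_ip : inner_product Q.
Hypothesis e_on : orthonormal_basis Q e.

(* gradF as a polynomial in the matrices ad_mx mu (stdv i). *)
Let ad_of (a : 'I_n -> 'M[R]_n) (x : 'cV[R]_n) := \sum_l x l 0 *: a l.
Let Ric_of (a : 'I_n -> 'M[R]_n) : 'M[R]_n :=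
  - 2^-1 *: (\sum_i transp Q (ad_of a (e i)) *m ad_of a (e i))
  + 4^-1 *: (\sum_i ad_of a (e i) *m transp Q (ad_of a (e i))).
(** The differences of [gl_act] are written as sums with a factor -1, to match [lipmD] and
    [lipmZ]. *)
Let gradF_of (a : 'I_n -> 'M[R]_n) i j : 'cV[R]_n :=
  Ric_of a *m (a i *m stdv R j) + (-1) *: (ad_of a (Ric_of a *m stdv R i) *m stdv R j)
  + (-1) *: (a i *m (Ric_of a *m stdv R j)).

Let gradF_ofE mu i j : skew_bilinear mu ->
  gradF Q e mu (stdv R i) (stdv R j) = gradF_of (fun l => ad_mx mu (stdv R l)) i j.
Proof.
move=> mu_V.
have adE x : ad_of (fun l => ad_mx mu (stdv R l)) x = ad_mx mu x.
  rewrite {2}[x]stdv_decomp (ad_sum mu_V).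
  by apply: eq_bigr => l _; rewrite (adZ mu_V).
have RicE : Ric_of (fun l => ad_mx mu (stdv R l)) = Ric Q e mu.
  by congr (_ *: _ + _ *: _); apply: eq_bigr => l _; rewrite adE.
by rewrite /gradF_of RicE adE !scaleN1r -!(br_ad mu_V).
Qed.

Section Lipschitz.
Variables (I : set R) (d : R -> R).
Hypothesis d_ge0 : forall s, I s -> 0 <= d s.
Variables a b : 'I_n -> R -> 'M[R]_n.
Hypothesis ab : forall i, lipm I d (a i) (b i).

Let lipm_ad_of (x y : R -> 'cV[R]_n) : lipm I d x y ->
  lipm I d (fun s => ad_of (a^~ s) (x s)) (fun s => ad_of (b^~ s) (y s)).
Proof.
move=> xy; apply: (lipm_sum d_ge0) => l _ i j.
by apply: lip2_ext (lip2M d_ge0 (xy l 0) (ab l i j)) => s; rewrite mxE.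
Qed.

Let lipm_transp (x y : R -> 'M[R]_n) : lipm I d x y ->
  lipm I d (fun s => transp Q (x s)) (fun s => transp Q (y s)).
Proof.
move=> xy; apply: (lipmM d_ge0); last exact: lipm_cst.
by apply: (lipmM d_ge0); [exact: lipm_cst|exact: lipm_tr].
Qed.

Let lipm_Ric_of : lipm I d (fun s => Ric_of (a^~ s)) (fun s => Ric_of (b^~ s)).
Proof.
have ade i := lipm_ad_of (lipm_cst d_ge0 (e i)).
apply: lipmD; apply: (lipmZ d_ge0); apply: (lipm_sum d_ge0) => i _;
  by apply: (lipmM d_ge0) => //; exact: lipm_transp.
Qed.

Lemma lipm_gradF_of i j :
  lipm I d (fun s => gradF_of (a^~ s) i j) (fun s => gradF_of (b^~ s) i j).
Proof.
have cst p q (M : 'M[R]_(p, q)) := lipm_cst d_ge0 M.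
apply: lipmD; first apply: lipmD.
- by apply: (lipmM d_ge0) => //; apply: (lipmM d_ge0).
- apply: (lipmZ d_ge0); apply: (lipmM d_ge0) => //; apply: lipm_ad_of.
  exact: (lipmM d_ge0).
- apply: (lipmZ d_ge0); apply: (lipmM d_ge0) => //.
  exact: (lipmM d_ge0).
Qed.

End Lipschitz.

Let flow_dwithin J mu0 mu : neg_gradient_flow Q e J mu0 mu -> forall t, J t ->
  forall i j k, dwithin J (fun s => mu s (stdv R i) (stdv R j) k 0) t
    (- gradF_of (fun l => ad_mx (mu t) (stdv R l)) i j k 0).
Proof.
move=> [mu_V mu_ode _] t Jt i j k; have [G GF dG] := mu_ode t Jt.
have GE := gradient_uniq Q_ip e_on GF (is_gradient_gradF Q_ip e_on (mu_V t Jt)).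
have /deriv_withinP/(_ k 0) := dG (stdv R i) (stdv R j).
by rewrite GE (gradF_ofE _ _ (mu_V t Jt)) mxE.
Qed.

(** The squared distance [w] of the structure constants is differentiable, and the solutions are
    bounded on the compact segment, so the polynomial field is Lipschitz along them and |w'| <= C
    w. *)
Lemma flow_uniq_segment mu0 nu0 a b mu nu : a <= b ->
  neg_gradient_flow Q e `[a, b]%classic mu0 mu ->
  neg_gradient_flow Q e `[a, b]%classic nu0 nu ->
  mu a = nu a \/ mu b = nu b -> mu a = nu a /\ mu b = nu b.
Proof.
move=> ab muF nuF.
pose m (p : 'I_n * 'I_n * 'I_n) s := mu s (stdv R p.1.1) (stdv R p.1.2) p.2 0.
pose k (p : 'I_n * 'I_n * 'I_n) s := nu s (stdv R p.1.1) (stdv R p.1.2) p.2 0.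
pose m' (p : 'I_n * 'I_n * 'I_n) s :=
  - gradF_of (fun l => ad_mx (mu s) (stdv R l)) p.1.1 p.1.2 p.2 0.
pose k' (p : 'I_n * 'I_n * 'I_n) s :=
  - gradF_of (fun l => ad_mx (nu s) (stdv R l)) p.1.1 p.1.2 p.2 0.
pose w s := \sum_p (m p s - k p s) ^+ 2.
pose w' s := \sum_p ((m' p s - k' p s) * (m p s - k p s) +
                     (m p s - k p s) * (m' p s - k' p s)).
pose I := `[a, b]%classic; pose d s := Num.sqrt (w s).
have inI x : I x = (a <= x <= b) :> Prop by rewrite /I /= in_itv.
have md p x : a <= x <= b -> dwithin I (m p) x (m' p x).
  by rewrite -inI => Ix; exact: (flow_dwithin muF Ix).
have kd p x : a <= x <= b -> dwithin I (k p) x (k' p x).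
  by rewrite -inI => Ix; exact: (flow_dwithin nuF Ix).
have w_ge0 s : 0 <= w s by apply: sumr_ge0 => p _; exact: sqr_ge0.
have d_ge0 s : I s -> 0 <= d s by move=> _; exact: sqrtr_ge0.
have mk_d p s : `|m p s - k p s| <= d s.
  rewrite -sqrtr_sqr; apply: ler_wsqrtr.
  rewrite /w (bigD1 p) //= lerDl; apply: sumr_ge0 => q _; exact: sqr_ge0.
have mk p : lip2 I d (m p) (k p).
  have [C C0 HC] := dwithin_bounded ab (md p).
  have [D D0 HD] := dwithin_bounded ab (kd p).
  (* The summand 1 covers the Lipschitz bound of a coordinate by the distance itself. *)
  exists (C + D + 1); first by rewrite !addr_ge0.
  move=> s; rewrite inI => Is; have h1 := HC s Is; have h2 := HD s Is; split.
  - lra.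
  - lra.
  - apply: le_trans (mk_d p s) _; rewrite ler_peMl ?sqrtr_ge0 //; lra.
have lipA i : lipm I d (fun s => ad_mx (mu s) (stdv R i)) (fun s => ad_mx (nu s) (stdv R i)).
  by move=> q j; apply: lip2_ext (mk (i, j, q)) => s; rewrite mxE.
have lipX p : {C | 0 <= C & forall s, I s -> `|m' p s - k' p s| <= C * d s}.
  (* The constants are chosen as data, so that they can be summed over [p] in the definition of
     [C]. *)
  apply: cid2; have [C C0 H] := lipm_gradF_of d_ge0 lipA p.1.1 p.1.2 p.2 0.
  exists C => // s /H[_ _]; rewrite /m' /k' -opprD normrN //.
have w_dwithin x : a <= x <= b -> dwithin I w x (w' x).
  move=> xab; apply: dwithin_sum => p _; have D := dwithin_sub (md p x xab) (kd p x xab).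
  by apply: dwithin_ext (dwithin_mul D D) => s; rewrite expr2.
pose C := \sum_p 2 * s2val (lipX p).
have w_bound x : a <= x <= b -> `|w' x| <= C * w x.
  move=> xab; apply: le_trans (ler_norm_sum _ _ _) _; rewrite /C mulr_suml.
  apply: ler_sum => p _; case: (lipX p) => c c0 /= H.
  move: (m' p x - k' p x) (m p x - k p x) (H x) (mk_d p x) => u v Hu Hv.
  have -> : u * v + v * u = 2 * (u * v) by ring.
  rewrite normrM normr_nat -mulrA ler_pM2l // normrM.
  have Hx : `|u| <= c * d x by apply: Hu; rewrite inI.
  apply: le_trans (ler_pM _ _ Hx Hv) _ => //.
  by rewrite -mulrA -expr2 /d sqr_sqrtr.
have w0 s : I s -> w s = 0 <-> mu s = nu s.
  move=> Is; split=> [ws|E]; last first.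
    by rewrite /w big1 // => p _; rewrite /m /k E subrr expr0n.
  have mk0 p : m p s = k p s.
    apply/eqP; rewrite -subr_eq0 -normr_le0; apply: le_trans (mk_d p s) _.
    by rewrite /d ws sqrtr0.
  have mu_V : skew_bilinear (mu s) by case: muF => /(_ s Is).
  have nu_V : skew_bilinear (nu s) by case: nuF => /(_ s Is).
  apply/funext => x; apply/funext => y; rewrite (br_ad mu_V) (br_ad nu_V).
  congr (_ *m _); rewrite [x]stdv_decomp (ad_sum mu_V) (ad_sum nu_V).
  apply: eq_bigr => i _; rewrite (adZ mu_V) (adZ nu_V); congr (_ *: _).
  by apply/matrixP => q j; rewrite !mxE; exact: (mk0 (i, j, q)).
have Ia : I a by rewrite inI lexx.
have Ib : I b by rewrite inI lexx andbT.
have := dwithin_gronwall ab w_dwithin (fun x _ => w_ge0 x) w_bound.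
rewrite !w0 //; apply.
Qed.

Lemma flow_subset (J J' : set R) mu0 mu : J' `<=` J ->
  neg_gradient_flow Q e J mu0 mu -> neg_gradient_flow Q e J' mu0 mu.
Proof.
move=> sJ [mu_V mu_ode mu00]; split => // [t /sJ/mu_V//|t /sJ/mu_ode[G GF dG]].
exists G => // x y; apply/deriv_withinP => i j.
apply: (dwithin_subset sJ); exact: (proj1 (deriv_withinP _ _ _ _) (dG x y)).
Qed.

Lemma flow_uniq (J : set R) mu0 mu nu : is_interval J -> J 0 ->
  neg_gradient_flow Q e J mu0 mu -> neg_gradient_flow Q e J mu0 nu ->
  forall t, J t -> nu t = mu t.
Proof.
move=> J_itv J0 muF nuF t Jt.
have E0 : mu 0 = nu 0 by case: muF => _ _ ->; case: nuF.
have sub a b : J a -> J b -> `[a, b]%classic `<=` J.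
  by move=> Ja Jb x; rewrite /= in_itv /=; exact: J_itv.
have [t0|/ltW t0] := leP 0 t.
  have [_ ->] // := flow_uniq_segment t0 (flow_subset (sub _ _ J0 Jt) muF)
    (flow_subset (sub _ _ J0 Jt) nuF) (or_introl E0).
have [->] // := flow_uniq_segment t0 (flow_subset (sub _ _ Jt J0) muF)
    (flow_subset (sub _ _ Jt J0) nuF) (or_intror E0).
Qed.

End FlowUniqueness.

(** * The pulled-back flow *)

Section ChangeOfVariables.
Variables (R : realType) (n : nat).

(** Polynomial maps are differentiable, so the directional derivative is linear in [v]. *)
Lemma derive_jacobian (b : 'cV[R]_n -> 'cV[R]_n) z v k : vanm 0 b ->
  'D_v (fun y => b y k 0) z = (jacobian_mx b z *m v) k 0.
Proof.
move=> b0; have D := van_differentiable z (b0 k 0).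
rewrite (deriveE v D) {1}[v]stdv_decomp linear_sum /= mxE.
by apply: eq_bigr => j _; rewrite linearZ /= mxE /partial (deriveE _ D) mulrC.
Qed.

Lemma jacobian_mulmx (M : 'M[R]_n) x : jacobian_mx (mulmx M) x = M.
Proof.
apply/matrixP => k j; rewrite mxE; apply: dwithin_derive.
have := dwithinmx_mull M (@dwithinmx_line _ _ x (stdv R j)).
by move=> /(_ k 0); rewrite -colE mxE.
Qed.

Lemma jacobian_conj (h k : 'M[R]_n) (b : 'cV[R]_n -> 'cV[R]_n) x : vanm 0 b ->
  jacobian_mx (fun y => h *m b (k *m y)) x = h *m jacobian_mx b (k *m x) *m k.
Proof.
move=> b0; apply/matrixP => i j; rewrite mxE; apply: dwithin_derive.
have B : dwithinmx setT (fun s => b (k *m (s *: stdv R j + x))) 0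
    (jacobian_mx b (k *m x) *m (k *m stdv R j)).
  move=> l c; rewrite (ord1 c) -(derive_jacobian _ _ _ b0).
  apply: dwithin_ext (derive_dwithin (van_derivable _ _ (b0 l 0))) => s.
  by rewrite mulmxDr -scalemxAr.
have := dwithinmx_mull h B i 0.
by rewrite !mulmxA -colE mxE.
Qed.

End ChangeOfVariables.

Section LeftInvariantMetrics.
Variables (R : realType) (n : nat) (mu : bracket R n).
Hypothesis mu_V : skew_bilinear mu.
Hypothesis mu_nil : nilpotent_bracket mu.

Lemma jacobian_bch0 : jacobian_mx (bch mu (- 0)) 0 = 1%:M.
Proof.
have [r r3 ->] := bch_jacobian_jet mu_V mu_nil.
rewrite (ad0 mu_V) mulmx0 !scaler0 subr0 addr0.
have -> : r 0 = 0 by apply/matrixP => i j; rewrite (van_at0 (r3 i j)) mxE.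
by rewrite addr0.
Qed.

Lemma left_invariant_metric0 Q : left_invariant_metric mu Q 0 = Q.
Proof.
by rewrite /left_invariant_metric /pullback jacobian_bch0 trmx1 mul1mx mulmx1.
Qed.

(** By naturality [h] is a group isomorphism, so it conjugates the left translations of the two
    groups; the outer factor [h] of the conjugate is the one that turns [Q] into [g 0]. *)
Lemma pullback_left_invariant (g : metric R n) (h Q : 'M[R]_n) :
  h \in unitmx -> left_invariant mu g -> g 0 = h^T *m Q *m h ->
  pullback (mulmx (invmx h)) g = left_invariant_metric (act mu h) Q.
Proof.
move=> h_unit g_inv g0; apply/funext => x; rewrite /pullback jacobian_mulmx.
rewrite (left_invariantE mu_V g_inv) g0 /left_invariant_metric /pullback.
have -> : bch (act mu h) (- x) =
    fun y => h *m bch mu (- (invmx h *m x)) (invmx h *m y).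
  apply/funext => y; rewrite -(bch_act h_unit mu_V mu_nil) mulmxN.
  by rewrite !mulKVmx.
rewrite jacobian_conj; last exact: bch_polynomial.
by rewrite !trmx_mul !mulmxA.
Qed.

End LeftInvariantMetrics.

Theorem mainTheorem6 (R : realType) (n : nat)
    (Q : 'M[R]_n) (e : 'I_n -> 'cV[R]_n) (mu0 : bracket R n)
    (J : set R) (g : R -> metric R n) (h : R -> 'M[R]_n)
    (Q_ip : inner_product Q) (e_on : orthonormal_basis Q e)
    (mu0_N : nilpotent_lie mu0)
    (J_itv : is_interval J) (J0 : J 0)
    (g_flow : ricci_flow J g)
    (g_inv : forall t, J t -> left_invariant mu0 (g t))
    (g0 : g 0 = left_invariant_metric mu0 Q)
    (h_unit : forall t, J t -> h t \in unitmx)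
    (h_ode : forall t, J t ->
       deriv_within J h t (- (h t *m ricci_operator (g t) 0)))
    (h0 : h 0 = 1%:M) :
  exists mu : R -> bracket R n,
    [/\ neg_gradient_flow Q e J mu0 mu,
        forall nu, neg_gradient_flow Q e J mu0 nu ->
          forall t, J t -> nu t = mu t,
        forall t, J t -> nilpotent_lie (mu t) &
        forall t, J t ->
          pullback (mulmx (invmx (h t))) (g t)
            = left_invariant_metric (mu t) Q].
Proof.
have [mu0_V _ mu0_nil] := mu0_N; have [g_riem g_ode] := g_flow.
have dh t : J t -> dwithinmx J h t (- (h t *m ricci_operator (g t) 0)).
  by move=> Jt; apply/deriv_withinP; exact: h_ode.
have dhi t : J t ->
    dwithinmx J (fun s => invmx (h s)) t (ricci_operator (g t) 0 *m invmx (h t)).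
  move=> Jt; have := dwithinmx_invmx h_unit (h_unit t Jt) (dh t Jt).
  by rewrite mulmxN mulNmx opprK mulKmx // h_unit.
have G_unit t : J t -> g t 0 \in unitmx.
  by move=> Jt; apply: inner_product_unit; case: (g_riem t Jt).
have G_sym t : J t -> (g t 0)^T = g t 0 by move=> Jt; case: (g_riem t Jt) => /(_ 0)[].
(* The derivative of (h^-1)^* g at the origin is
   h^-T (Ric^T g - 2 Rc + g Ric) h^-1 = 0. *)
pose q s := (invmx (h s))^T *m g s 0 *m invmx (h s).
have dq t : J t -> dwithinmx J q t 0.
  move=> Jt; have dg : dwithinmx J (fun s => g s 0) t (- 2 *: ricci_tensor (g t) 0).
    by apply/deriv_withinP; exact: g_ode.
  have := dwithinmx_mul (dwithinmx_mul (dwithinmx_tr (dhi t Jt)) dg) (dhi t Jt).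
  set r := ricci_operator (g t) 0; set T := ricci_tensor (g t) 0.
  have gr : g t 0 *m r = T by rewrite /r /ricci_operator mulKVmx // G_unit.
  have rg : r^T *m g t 0 = T.
    rewrite -(G_sym t Jt) -trmx_mul gr.
    exact: ricci_tensor_sym mu0_V mu0_nil (g_riem t Jt) (g_inv t Jt).
  have -> : (r *m invmx (h t))^T *m g t 0 = (invmx (h t))^T *m T.
    by rewrite trmx_mul -mulmxA rg.
  have -> : (invmx (h t))^T *m g t 0 *m (r *m invmx (h t)) =
      (invmx (h t))^T *m T *m invmx (h t) by rewrite -gr !mulmxA.
  rewrite -mulmxDl -scalemxAr.
  suff -> : (invmx (h t))^T *m T + (- 2) *: ((invmx (h t))^T *m T)
      + (invmx (h t))^T *m T = 0 by rewrite mul0mx.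
  by rewrite scaleNr scaler_nat mulr2n addrAC subrr.
have q0 : q 0 = Q.
  by rewrite /q h0 invmx1 trmx1 mul1mx mulmx1 g0 left_invariant_metric0.
have sub a b : J a -> J b -> `[a, b]%classic `<=` J.
  by move=> Ja Jb x; rewrite /= in_itv /=; exact: J_itv.
(* The mean value theorem on a segment inside J, where one-sided derivatives at its end points
   suffice. *)
have q_cst a b : a <= b -> J a -> J b -> q b = q a.
  move=> ab Ja Jb; apply/matrixP => i j; apply/eqP; rewrite -subr_eq0.
  have [|c _ ->] := @dwithin_MVT _ a b (fun s => q s i j) (fun=> 0) ab; last by rewrite mul0r.
  move=> x xab; apply: (dwithin_subset (sub a b Ja Jb)).
  have := dq x _ i j; rewrite mxE; apply; apply: (sub a b Ja Jb).
  by rewrite /= in_itv.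
have qE t : J t -> q t = Q.
  move=> Jt; rewrite -q0; have [t0|/ltW t0] := leP 0 t; first exact: q_cst.
  by apply/esym; exact: q_cst.
have gE t : J t -> g t 0 = (h t)^T *m Q *m h t.
  move=> Jt; rewrite -(qE t Jt) /q !mulmxA -trmx_mul mulVmx ?h_unit // trmx1 mul1mx.
  by rewrite mulmxKV // h_unit.
(* The vectors h(t)^-1 e_i are orthonormal for g(t)(0) = h(t)^T Q h(t), so [ricci_operator_at0]
   applies to this frame. *)
have RicE t : J t ->
    Ric Q e (act mu0 (h t)) = h t *m ricci_operator (g t) 0 *m invmx (h t).
  move=> Jt; rewrite (Ric_act _ (h_unit t Jt) (inner_product_unit Q_ip) mu0_V).
  rewrite -gE //.
  rewrite -(ricci_operator_at0 mu0_V mu0_nil (g_riem t Jt) (g_inv t Jt)) //.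
  by rewrite gE //; apply: orthonormal_pullback => //; exact: h_unit.
pose mu t := act mu0 (h t).
have mu_V t : J t -> skew_bilinear (mu t) by move=> Jt; exact: act_skew.
have flow : neg_gradient_flow Q e J mu0 mu.
  split => [//|t Jt|].
    exists (gradF Q e (mu t)); first exact: (is_gradient_gradF Q_ip e_on (mu_V t Jt)).
    move=> x y; apply/deriv_withinP.
    have dhx (z : 'cV[R]_n) := dwithinmx_mulr z (dhi t Jt).
    have := dwithinmx_mul (dh t Jt) (dwithinmx_br mu0_V (dhx x) (dhx y)).
    (* In the product rule h' contributes - Ric_mu mu(x, y), and the two derivatives of h^-1
       contribute mu(Ric_mu x, y) and mu(x, Ric_mu y). *)
    congr (dwithinmx _ _ _ _); rewrite /gradF /gl_act /mu RicE // /act.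
    have hV : invmx (h t) *m h t = 1%:M by rewrite mulVmx // h_unit.
    have E1 z : invmx (h t) *m (h t *m ricci_operator (g t) 0 *m invmx (h t) *m z) =
        ricci_operator (g t) 0 *m invmx (h t) *m z.
      by rewrite !mulmxA hV mul1mx.
    have E2 z : h t *m ricci_operator (g t) 0 *m invmx (h t) *m (h t *m z) =
        h t *m ricci_operator (g t) 0 *m z.
      by rewrite -!mulmxA [invmx (h t) *m (h t *m z)]mulmxA hV mul1mx.
    by rewrite !E1 E2 mulNmx mulmxDr !opprD !opprK addrA.
  by apply/funext => x; apply/funext => y; rewrite /mu /act h0 invmx1 !mul1mx.
exists mu; split => // [nu|t Jt|t Jt].
- exact: flow_uniq.
- by apply: act_nilpotent_lie => //; exact: h_unit.
- apply: pullback_left_invariant => //; [exact: h_unit|exact: g_inv|exact: gE].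
Qed.
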